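(* Let $l,m,n$ be positive integers with $\frac1l+\frac1m+\frac1n\le 1$. Then there exist infinitely many (pairwise non-isomorphic) orientably regular chiral hypermaps of type $(l,m,n)$.
   Context: For positive integers $l,m,n$, let $\Delta^*=\Delta^*(l,m,n)=\langle r_0,r_1,r_2\mid r_0^2=r_1^2=r_2^2=(r_1r_2)^l=(r_2r_0)^m=(r_0r_1)^n=1\rangle$ be the extended triangle group of type $(l,m,n)$, and let $\Delta=\Delta(l,m,n)=\langle x,y,z\mid x^l=y^m=z^n=xyz=1\rangle$ be the triangle group of that type, identified with the index-$2$ subgroup of $\Delta^*$ of words of even length via $x=r_1r_2$, $y=r_2r_0$, $z=r_0r_1$. The type $(l,m,n)$ is non-spherical if $\frac1l+\frac1m+\frac1n\le 1$. Orientably regular hypermaps $\mathcal H$ of non-spherical type $(l,m,n)$, up to isomorphism of oriented hypermaps (orientation-preserving isomorphism), correspond bijectively to torsion-free normal subgroups $N$ of $\Delta$, with orientation-preserving automorphism group $\mathrm{Aut}^+\mathcal H\cong\Delta/N$. (For normal $N$ of finite index, torsion-freeness means that the images of $x,y,z$ in $\Delta/N$ have orders exactly $l,m,n$.) The hypermap corresponding to $N$ is reflexible (regular) if $N$ is normal in $\Delta^*$, and chiral if $N$ is not normal in $\Delta^*$. *)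

(* Defs.v *)
From HB Require Import structures.
From mathcomp Require Import all_boot all_order all_algebra all_fingroup.
From mathcomp Require Import boolp classical_sets.

Set Implicit Arguments.
Unset Strict Implicit.
Unset Printing Implicit Defensive.

Import GroupScope.

(* The letter (t, false) stands for the generator t and (t, true) for its
   formal inverse. *)
Definition word (T : Type) := seq (T * bool).

Definition word_inv (T : Type) (w : word T) : word T :=
  rev [seq (a.1, ~~ a.2) | a <- w].

Definition word_pow (T : Type) (w : word T) (k : nat) : word T :=
  flatten (nseq k w).

Definition word_eval (T : Type) (G : groupType) (f : T -> G) (w : word T) : G :=
  \prod_(a <- w) (if a.2 then (f a.1)^-1 else f a.1).

Section PresentedGroup.
Variables (T : choiceType) (rels : seq (word T)).

Inductive word_cong : word T -> word T -> Prop :=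
| wc_refl u : word_cong u u
| wc_sym u v : word_cong u v -> word_cong v u
| wc_trans u v w : word_cong u v -> word_cong v w -> word_cong u w
| wc_cat u1 v1 u2 v2 :
    word_cong u1 v1 -> word_cong u2 v2 -> word_cong (u1 ++ u2) (v1 ++ v2)
| wc_cancel t b : word_cong [:: (t, b); (t, ~~ b)] [::]
| wc_rel r : r \in (rels : seq (seq (T * bool))) -> word_cong r [::].

Definition word_congb : rel (word T) := fun u v => `[< word_cong u v >].

Fact word_congb_refl : reflexive word_congb.
Proof. by move=> u; apply/asboolP; apply: wc_refl. Qed.

Fact word_congb_sym : symmetric word_congb.
Proof. by move=> u v; apply/asboolP/asboolP; apply: wc_sym. Qed.

Fact word_congb_trans : transitive word_congb.
Proof.
by move=> v u w /asboolP uv /asboolP vw; apply/asboolP; apply: wc_trans uv vw.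
Qed.

Canonical word_congb_equiv :=
  EquivRel word_congb word_congb_refl word_congb_sym word_congb_trans.

(* The group < T | rels >: words modulo the congruence generated by free
   cancellation and by setting every word in rels equal to 1. *)
Definition presented : Type := {eq_quot word_congb}%qT.
HB.instance Definition _ := Choice.copy presented {eq_quot word_congb}%qT.

Definition pclass (w : word T) : presented := \pi_({eq_quot word_congb})%qT w.
Definition prepr (g : presented) : word T :=
  generic_quotient.repr (g : {eq_quot word_congb}%qT).

Definition pmul (g h : presented) : presented := pclass (prepr g ++ prepr h).
Definition pone : presented := pclass [::].
Definition pinv (g : presented) : presented := pclass (word_inv (prepr g)).

Fact preprK : cancel prepr pclass.
Proof. exact: reprK. Qed.

Fact pclassP u v : pclass u = pclass v <-> word_cong u v.
Proof.
split=> [uv|uv]; last by apply/eqmodP/asboolP.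
by apply/asboolP; apply/(eqmodP word_congb_equiv).
Qed.

Fact pclass_cat u v : pclass (u ++ v) = pmul (pclass u) (pclass v).
Proof.
by apply/pclassP; apply: wc_cat; apply/pclassP; rewrite preprK.
Qed.

Fact pmulA : associative pmul.
Proof.
move=> g h k; rewrite -(preprK g) -(preprK h) -(preprK k).
by rewrite -!pclass_cat catA.
Qed.

Fact pmul1g : left_id pone pmul.
Proof. by move=> g; rewrite -(preprK g) -pclass_cat. Qed.

Fact pmulg1 : right_id pone pmul.
Proof. by move=> g; rewrite -(preprK g) -pclass_cat cats0. Qed.

Fact word_inv_cat w : word_cong (word_inv w ++ w) [::].
Proof.
elim: w => [|[t b] w IHw]; first exact: wc_refl.
rewrite /word_inv /= rev_cons cat_rcons -/(word_inv w).
apply: (wc_trans _ IHw); apply: wc_cat; first exact: wc_refl.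
have := wc_cat (wc_cancel t (~~ b)) (wc_refl w).
by rewrite negbK.
Qed.

Fact pmulVg : left_inverse pone pinv pmul.
Proof.
move=> g; rewrite -{2}(preprK g) -pclass_cat.
by apply/pclassP; apply: word_inv_cat.
Qed.

Fact pmulgV : right_inverse pone pinv pmul.
Proof.
move=> g; have gVV : pinv (pinv g) = g.
  by rewrite -[LHS]pmulg1 -(pmulVg g) pmulA pmulVg pmul1g.
by rewrite -{1}gVV pmulVg.
Qed.

HB.instance Definition _ :=
  isGroup.Build presented pmulA pmul1g pmulg1 pmulVg pmulgV.

Definition pgen (t : T) : presented := pclass [:: (t, false)].

End PresentedGroup.

Definition i0 : 'I_3 := @Ordinal 3 0 isT.
Definition i1 : 'I_3 := @Ordinal 3 1 isT.
Definition i2 : 'I_3 := @Ordinal 3 2 isT.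

Definition triple (A : Type) (a b c : A) : 'I_3 -> A := tnth [tuple a; b; c].

Definition prod2 (i j : 'I_3) : word 'I_3 := [:: (i, false); (j, false)].

Definition ext_triangle_rels (l m n : nat) : seq (word 'I_3) :=
  [:: prod2 i0 i0; prod2 i1 i1; prod2 i2 i2;
      word_pow (prod2 i1 i2) l; word_pow (prod2 i2 i0) m;
      word_pow (prod2 i0 i1) n].

Definition ext_triangle_group (l m n : nat) : groupType :=
  presented (ext_triangle_rels l m n).

Definition reflection (l m n : nat) (i : 'I_3) : ext_triangle_group l m n :=
  pgen (ext_triangle_rels l m n) i.

(* The generators x = r1 r2, y = r2 r0, z = r0 r1 of the triangle group, which
   is thereby the even subgroup of the extended triangle group. *)
Definition rotation (l m n : nat) : 'I_3 -> ext_triangle_group l m n :=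
  let r := reflection l m n in
  triple (r i1 * r i2) (r i2 * r i0) (r i0 * r i1).

(* Finite oriented hypermaps: the cycles of x, y and z on the darts are the
   hypervertices, hyperedges and hyperfaces. Transitivity on [set: dart]
   entails that there is at least one dart. *)
Record hypermap := Hypermap {
  dart : finType;
  hx : {perm dart};
  hy : {perm dart};
  hz : {perm dart};
  hxyz : hx * hy * hz = 1;
  htrans : [transitive <<[set hx; hy; hz]>>, on [set: dart] | 'P]
}.

Definition has_type (l m n : nat) (H : hypermap) : Prop :=
  [/\ #[hx H] = l, #[hy H] = m & #[hz H] = n].

(* Isomorphisms of oriented hypermaps, hence orientation-preserving. *)
Definition is_isom (H K : hypermap) (f : dart H -> dart K) : Prop :=
  [/\ bijective f, forall d, f (hx H d) = hx K (f d),
      forall d, f (hy H d) = hy K (f d) & forall d, f (hz H d) = hz K (f d)].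

Definition isomorphic (H K : hypermap) : Prop :=
  exists f : dart H -> dart K, is_isom f.

Definition orientably_regular (H : hypermap) : Prop :=
  forall d e : dart H, exists2 f : dart H -> dart H, is_isom f & f d = e.

(* The kernel of the action of the triangle group on the darts of a hypermap of
   type (l, m, n), as a subset of the extended triangle group. If the hypermap
   is orientably regular, this is also the stabiliser of each dart. *)
Definition hypermap_subgroup (l m n : nat) (H : hypermap) :
    set (ext_triangle_group l m n) :=
  [set g | exists2 w : word 'I_3,
     word_eval (triple (hx H) (hy H) (hz H)) w = 1 &
     g = word_eval (rotation l m n) w]%classic.

Arguments hypermap_subgroup : clear implicits.

(* Normality of N in the whole of G, for N a subgroup of G. *)
Definition invariant_under_conj (G : groupType) (N : set G) : Prop :=
  forall g h : G, N g -> N (g ^ h).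

Definition reflexible (l m n : nat) (H : hypermap) : Prop :=
  invariant_under_conj (hypermap_subgroup l m n H).

Definition chiral (l m n : nat) (H : hypermap) : Prop := ~ reflexible l m n H.

(* Main.v *)
(* Let G = <y, z> be a finite quotient of the triangle group in which y, z and
   yz have orders exactly m, n and l, acting regularly on d points by the
   permutations s and t, and let V = F_p^d be its permutation module. For h in V
   let y act on V as a linear map (a rotation about 0) and z as the affine
   rotation about h with the same linear part as before. The product is again a
   rotation, hence of order l, if v = h is a nonzero solution of
     (1 - a) (v - v t) = (1 + a) (v - v s^-1)
   for some scalar a other than 0, 1, -1. The resulting affine group is chiral if
   some word is trivial while its mirror image, with y and z inverted, is not.

   If there were no such word, averaging over G would give an affine map
   intertwining the action with its mirror image, so that, with some k solving
   the mirrored equation, h - k would be a sum of a vector fixed by s and a vector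
   fixed by t. Over the complex numbers this is impossible: with h of shape
   r = (1 + a) / (1 - a) and k of mirrored shape r, <h - h t, k> is multiplied by
   r^* / r, so it vanishes if r is not real, whereas its real part is
   |h - h t|^2 / 2; real r other than 1 do not occur at all. Such an a exists over
   the complex numbers by a count of dimensions, which is where non-sphericity
   comes in. Both facts are about polynomials with integer coefficients in a, and
   so pass to F_p, with a in F_p, for infinitely many p. *)
Require Import Defs.
From HB Require Import structures.
From mathcomp Require Import all_boot all_order all_algebra all_fingroup.
From mathcomp Require Import all_solvable all_field.
From mathcomp Require Import ring zify.

Set Implicit Arguments.
Unset Strict Implicit.
Unset Printing Implicit Defensive.

Import Order.TTheory GRing.Theory Num.Theory.
Local Open Scope ring_scope.

(** * Prime divisors of values of integer polynomials *)

(* Euclid's argument applied to the values f(c b! j), where c = f(0). *)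
Lemma prime_dvd_poly_value (f : {poly int}) (b : nat) : (1 < size f)%N ->
  exists2 p : nat, prime p /\ (b < p)%N & exists k : int, (p%:Z %| f.[k])%Z.
Proof.
move=> sf; pose c := f.[0]; have [p b_lt_p p_pr] := prime_above b.
have [c0|c_neq0] := eqVneq c 0.
  by exists p => //; exists 0; rewrite -/c c0 dvdz0.
have [q deff] : exists q, f = q * 'X + c%:P.
  have /factor_theorem[q qP] : root (f - c%:P) 0.
    by rewrite rootE !hornerE subrr.
  by exists q; rewrite -[LHS](subrK c%:P) qP subr0.
pose e (j : nat) : int := 1 + b`!%:Z * (j%:Z * q.[c * b`!%:Z * j%:Z]).
have fE j : f.[c * b`!%:Z * j%:Z] = c * e j.
  by rewrite {1}deff hornerD hornerMX hornerC /e; move: (b`!%:Z) (j%:Z) => u v; ring.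
(* The roots of [g] are the points where f takes one of the values c and -c, that is, where [e j] is
   1 or -1. There are fewer roots than [size g], so some j below [size g] gives [e j] a prime factor
   or the value 0. *)
pose g := (f - c%:P) * (f + c%:P).
have g_neq0 : g != 0.
  have sz u : f + u%:P != 0.
    have su : (size u%:P <= 1)%N := size_polyC_leq1 u.
    by rewrite -size_poly_gt0 size_polyDl; lia.
  by rewrite mulf_neq0 // -polyCN.
have /hasP[j _ ej] : has (fun j => `|e j|%N != 1%N) (iota 0 (size g)).
  apply: contraT; rewrite -all_predC => /allP /= all1.
  pose rs := [seq c * b`!%:Z * j%:Z | j <- iota 0 (size g)].
  have : (size rs < size g)%N.
    apply: max_poly_roots => //.
      apply/allP => _ /mapP[j /all1 + ->]; rewrite negbK => /eqP ej.
      rewrite rootE hornerM hornerD hornerN hornerC hornerD hornerC fE.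
      case: (e j) ej => [[|[|]]|[|]] //= _; first by rewrite mulr1 subrr mul0r.
      by rewrite NegzE mulrN mulr1 addNr mulr0.
    rewrite map_inj_uniq ?iota_uniq // => i j.
    have cb : c * b`!%:Z != 0.
      by rewrite mulf_neq0 //; have := fact_gt0 b; lia.
    by move/(mulfI cb) => [].
  by rewrite size_map size_iota ltnn.
have [e0|e_neq0] := eqVneq (e j) 0.
  by exists p => //; exists (c * b`!%:Z * j%:Z); rewrite fE e0 mulr0 dvdz0.
have r_pr : prime (pdiv `|e j|).
  by apply: pdiv_prime; move: ej e_neq0; rewrite -absz_eq0; lia.
have r_dvd : ((pdiv `|e j|)%:Z %| e j)%Z by rewrite dvdzE pdiv_dvd.
exists (pdiv `|e j|).
  (* A prime factor of [e j] that is at most b divides b!, hence [e j - 1], hence 1. *)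
  split=> //; rewrite ltnNge; apply/negP => le_b.
  have : ((pdiv `|e j|)%:Z %| b`!%:Z)%Z.
    by rewrite dvdzE dvdn_fact // prime_gt0.
  move=> /(dvdz_mulr (j%:Z * q.[c * b`!%:Z * j%:Z])) d2.
  have := r_dvd; rewrite /e rpredDr // dvdzE /= dvdn1 => /eqP r1.
  by rewrite /e r1 in r_pr.
by exists (c * b`!%:Z * j%:Z); rewrite fE dvdz_mull.
Qed.

Lemma intr_Fp_eq0 (p : nat) (k : int) : prime p ->
  (k%:~R == 0 :> 'F_p) = (p%:Z %| k)%Z.
Proof.
move=> p_pr; rewrite dvdzE /= (dvdn_pcharf (pchar_Fp p_pr)).
by case: k => k //=; rewrite NegzE mulrNz oppr_eq0.
Qed.

(** Over the rationals, the largest divisor of D coprime to m still has the root [lam], so it is not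
    constant and has roots modulo arbitrarily large primes. A Bezout identity keeps m from vanishing
    at such a root. *)
Lemma root_mod_prime (D m : {poly int}) (lam : algC) (b : nat) :
    D != 0 -> root (map_poly intr D) lam -> ~~ root (map_poly intr m) lam ->
  exists2 p : nat, prime p /\ (b < p)%N &
    exists2 a : 'F_p, root (map_poly intr D) a & ~~ root (map_poly intr m) a.
Proof.
move=> D0 rD rm.
pose Dq : {poly rat} := map_poly intr D; pose mq : {poly rat} := map_poly intr m.
have mapC (q : {poly int}) :
    map_poly (ratr : rat -> algC) (map_poly intr q) = map_poly intr q.
  by rewrite -map_poly_comp; apply: eq_map_poly => z /=; rewrite ratr_int.
have Dq0 : Dq != 0 by rewrite map_poly_eq0_id0 // intr_eq0 lead_coef_eq0.
pose D1 := gdcop mq Dq.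
have rD1 : root (map_poly (ratr : rat -> algC) D1) lam.
  rewrite gdcop_map !mapC root_gdco ?rD ?rm //.
  by rewrite map_poly_eq0_id0 // intr_eq0 lead_coef_eq0.
have /Bezout_coprimepP[[u w] /= uw] : coprimep D1 mq by apply: coprimep_gdco.
have /dvdpP[E defE] : D1 %| Dq by apply: dvdp_gdco.
have [D1' [d1 d10 D1E]] := rat_poly_scale D1.
have [u' [du du0 uE]] := rat_poly_scale u.
have [w' [dw dw0 wE]] := rat_poly_scale w.
have [E' [dE dE0 EE]] := rat_poly_scale E.
have /eqpP[[c1 c2] /= /andP[c10 c20] cE] := uw.
have injq : injective (map_poly (intr : int -> rat)).
  by apply: map_inj_poly => //; apply: intr_inj.
(* The Bezout identity with denominators cleared: a nonzero integer [Q] is a combination of [D1']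
   and [m] over the integer polynomials. *)
have [Q QN0 QE] : exists2 Q : int, Q != 0 &
    u' * D1' * dw%:P + w' * m * (du * d1)%:P = Q%:P.
  pose q : rat := c1^-1 * c2 * du%:~R * d1%:~R * dw%:~R.
  have q0 : q != 0 by rewrite !mulf_neq0 ?invr_eq0 ?intr_eq0.
  have e1 : map_poly intr (u' * D1' * dw%:P + w' * m * (du * d1)%:P) = q%:P.
    have uwE : u * D1 + w * mq = (c1^-1 * c2)%:P.
      have : c1^-1 *: (c1 *: (u * D1 + w * mq)) = (c1^-1 * c2)%:P.
        by rewrite cE scalerA alg_polyC.
      by rewrite scalerA mulVf // scale1r.
    have unscale (a : int) (r r' : {poly rat}) :
        a != 0 -> r = a%:~R^-1 *: r' -> r' = a%:~R%:P * r.
      by move=> a0 ->; rewrite mul_polyC scalerA divff ?scale1r ?intr_eq0.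
    have -> : q%:P = (u * D1 + w * mq) * du%:~R%:P * d1%:~R%:P * dw%:~R%:P.
      by rewrite uwE -!polyCM.
    rewrite rmorphD !rmorphM /= !map_polyC /= -/mq (unscale _ _ _ du0 uE).
    rewrite (unscale _ _ _ dw0 wE) (unscale _ _ _ d10 D1E).
    rewrite ?intrM ?polyCM.
    move: (du%:~R%:P) (dw%:~R%:P) (d1%:~R%:P) => x1 x2 x3; ring.
  have sz : (size (u' * D1' * dw%:P + w' * m * (du * d1)%:P)%R <= 1)%N.
    rewrite -(size_map_inj_poly (f := intr : int -> rat)) //; last exact: intr_inj.
    by rewrite e1 size_polyC leq_b1.
  have := size1_polyC sz; set Q := _`_0 => QE; exists Q => //.
  apply: contraNneq q0 => Q0; move: e1; rewrite QE Q0 map_polyC /= => /eqP.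
  by rewrite eq_sym polyC_eq0.
have sD1 : (1 < size D1')%N.
  have D1'0 : D1' != 0.
    apply: contraNneq Dq0 => D1'0.
    by rewrite defE D1E D1'0 rmorph0 scaler0 mulr0.
  rewrite ltnNge; apply/negP => /size1_polyC D1'C.
  move: rD1; rewrite D1E map_polyZ /= mapC rootZ ?fmorph_eq0 ?invr_eq0 ?intr_eq0 //.
  rewrite D1'C map_polyC rootC intr_eq0.
  by apply/negP; apply: contra D1'0; rewrite D1'C coefC eqxx polyC_eq0.
have EQ : E' * D1' = (dE * d1) *: D.
  apply: injq; rewrite rmorphM /= map_polyZ /= -/Dq defE EE D1E -scalerAl -scalerAr.
  rewrite !scalerA intrM -[LHS]scale1r; congr (_ *: _).
  by field; rewrite !intr_eq0 dE0 d10.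
(* The prime exceeds both constants, so [Q] and [dE * d1] stay nonzero modulo p: the first keeps k
   from being a root of [m], the second makes it a root of [D]. *)
have [p [p_pr pb] [k pk]] := prime_dvd_poly_value (b + `|Q| + `|dE * d1|) sD1.
have b_p : (b < p)%N by apply: leq_ltn_trans pb; rewrite -addnA leq_addr.
have Q_p : (`|Q| < p)%N by apply: leq_ltn_trans pb; rewrite addnAC leq_addl.
have d_p : (`|(dE * d1)%R| < p)%N by apply: leq_ltn_trans pb; rewrite leq_addl.
exists p; first by split.
have ndvd z : z != 0 -> (`|z| < p)%N -> (z%:~R != 0 :> 'F_p).
  move=> z0 zp; rewrite intr_Fp_eq0 // dvdzE /=; apply/negP => /dvdn_leq.
  by rewrite absz_gt0 z0 leqNgt zp => /(_ isT).
have evE (f : {poly int}) : (map_poly intr f).[k%:~R : 'F_p] = f.[k]%:~R.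
  by rewrite (horner_map (intr : {rmorphism int -> 'F_p})).
have D1p : D1'.[k]%:~R = 0 :> 'F_p by apply/eqP; rewrite intr_Fp_eq0.
exists k%:~R; rewrite rootE evE.
  have : ((E' * D1').[k])%:~R == 0 :> 'F_p by rewrite hornerM intrM D1p mulr0.
  by rewrite EQ hornerZ intrM mulf_eq0 (negPf (ndvd _ _ d_p)) ?mulf_neq0.
apply/negP => /eqP mp.
have : (Q%:~R == 0 :> 'F_p).
  rewrite -[Q](hornerC _ k) -QE !hornerE !intrD !intrM D1p mp.
  by rewrite !(mulr0, mul0r) addr0.
by rewrite (negPf (ndvd _ QN0 Q_p)).
Qed.

(** * Displacement matrices *)

(** [v *m disp s] is the displacement of v under s. For a centre h, [h *m disp s] is the translation
    part of the affine map with linear part s that fixes h. *)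
HB.lock Definition disp (R : pzRingType) (d : nat) (s : 'S_d) : 'M[R]_d :=
  1%:M - perm_mx s.
Arguments disp {R d}.
Canonical disp_unlockable := Unlockable disp.unlock.

(** The all-ones summand removes the constant vectors from the kernel; over the complex numbers the
    sum is invertible for a transitive pair. *)
Definition sym_part (R : pzRingType) (d : nat) (s t : 'S_d) : 'M[R]_d :=
  disp t + disp s^-1%g + const_mx 1.

(* For a != 0 and d != 0 in R, the kernel of [pencil s t a] consists of the v of
   sum 0 with (1 - a) (v - v t) = (1 + a) (v - v s^-1): for each i, the entries of
   v, v t and v s^-1 at i form a triangle of a fixed shape. *)
Definition pencil (R : pzRingType) (d : nat) (s t : 'S_d) (a : R) : 'M[R]_d :=
  disp t - disp s^-1%g - a *: sym_part R s t.

Section Disp.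
Variables (F : fieldType) (d : nat).
Implicit Types (s t : 'S_d) (v : 'rV[F]_d).
Local Notation J := (const_mx 1 : 'M[F]_d).

Lemma tr_disp s : (disp s)^T = disp s^-1%g :> 'M[F]_d.
Proof. by rewrite unlock linearB /= tr_perm_mx trmx1. Qed.

Lemma disp_sum s :
  disp s + disp s^-1%g = disp s *m disp s^-1%g :> 'M[F]_d.
Proof.
rewrite unlock mulmxBl mul1mx mulmxBr mulmx1 -perm_mxM mulgV perm_mx1.
by rewrite opprB addrC.
Qed.

Lemma mul_disp0 v s : (v *m disp s == 0) = (v *m perm_mx s == v).
Proof. by rewrite unlock mulmxBr mulmx1 subr_eq0 eq_sym. Qed.

Lemma mul_dispV0 v s : (v *m disp s^-1%g == 0) = (v *m disp s == 0).
Proof.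
rewrite !mul_disp0; apply/eqP/eqP => vE; rewrite -{1}vE -mulmxA -perm_mxM.
  by rewrite mulVg perm_mx1 mulmx1.
by rewrite mulgV perm_mx1 mulmx1.
Qed.

Lemma mul_disp0P v s : reflect (forall i, v 0 (s i) = v 0 i) (v *m disp s == 0).
Proof.
rewrite mul_disp0 -{2}(invgK s) -col_permE.
apply: (iffP eqP) => [vE i|vE].
  by rewrite -{1}vE mxE permK.
by apply/rowP => i; rewrite mxE -vE permKV.
Qed.

Lemma disp_J s : disp s *m J = 0.
Proof.
rewrite unlock mulmxBl mul1mx; apply/eqP; rewrite subr_eq0 eq_sym; apply/eqP.
by rewrite -row_permE; apply/matrixP => i j; rewrite !mxE.
Qed.

Lemma J_disp s : J *m disp s = 0.
Proof. by apply: trmx_inj; rewrite trmx_mul tr_disp trmx_const disp_J trmx0. Qed.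

Lemma mulJE v : v *m J = const_mx (\sum_i v 0 i).
Proof.
apply/rowP => j; rewrite !mxE; apply: eq_bigr => i _.
by rewrite !mxE mulr1.
Qed.

Lemma J_sqr : J *m J = d%:R *: J.
Proof.
apply/matrixP => i j; rewrite !mxE.
by under eq_bigr do rewrite !mxE mulr1; rewrite sumr_const card_ord mulr1.
Qed.

Lemma tr_sym_part s t : (sym_part F s t)^T = sym_part F s^-1 t^-1.
Proof.
by rewrite /sym_part linearD [in LHS]linearD /= !tr_disp trmx_const invgK addrAC.
Qed.

Lemma pencil_J s t (a : F) : pencil s t a *m J = - (a * d%:R) *: J.
Proof.
rewrite /pencil /sym_part mulmxBl mulmxBl -scalemxAl 2!mulmxDl !disp_J J_sqr.
by rewrite subrr addr0 !add0r scalerA scaleNr.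
Qed.

Lemma tr_pencil s t (a : F) : (pencil s t a)^T = pencil s^-1 t^-1 a.
Proof.
rewrite /pencil linearB /= linearZ /= tr_sym_part; congr (_ - _).
by rewrite linearB /= !tr_disp.
Qed.

(** The all-ones matrix annihilates displacements, so applying it to the equation isolates the
    coordinate sum of v, with the nonzero factor -a d. *)
Lemma pencilP v s t (a : F) : a != 0 -> d%:R != 0 :> F ->
  v *m pencil s t a = 0 <->
  v *m J = 0 /\ (1 - a) *: (v *m disp t) = (1 + a) *: (v *m disp s^-1%g).
Proof.
move=> a0 d0.
have vP : v *m pencil s t a = (1 - a) *: (v *m disp t) -
          (1 + a) *: (v *m disp s^-1%g) - a *: (v *m J).
  rewrite /pencil /sym_part 2!mulmxBr -scalemxAr 2!mulmxDr.
  move: (v *m disp t) (v *m disp s^-1%g) (v *m _) => x y z.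
  rewrite scalerBl scalerDl !scale1r !scalerDr !opprD !addrA.
  by congr (_ - _ - _); rewrite addrAC.
split=> [v0|[J0 vE]]; last by rewrite vP J0 vE subrr scaler0 subr0.
have J0 : v *m J = 0.
  have : v *m pencil s t a *m J = 0 by rewrite v0 mul0mx.
  rewrite -mulmxA pencil_J -scalemxAr => /eqP.
  by rewrite scaler_eq0 oppr_eq0 mulf_eq0 (negPf a0) (negPf d0) => /eqP.
split=> //; apply/eqP; rewrite -subr_eq0; move: vP; rewrite v0 J0 scaler0 subr0.
by move=> <-.
Qed.

Definition transitive_pair s t :=
  forall i j, exists2 g, g \in <<[set s; t]>>%g & g i = j.

Lemma const_of_fixed v s t : transitive_pair s t ->
  v *m disp s = 0 -> v *m disp t = 0 -> forall i j, v 0 i = v 0 j.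
Proof.
move=> tr_st /eqP/mul_disp0P vs /eqP/mul_disp0P vt i j.
pose G := [set g : 'S_d | [forall i, v 0 (g i) == v 0 i]].
have gG : group_set G.
  apply/group_setP; split=> [|g h]; rewrite !inE.
    by apply/forallP => k; rewrite perm1.
  move=> /forallP gv /forallP hv; apply/forallP => k.
  by rewrite permM (eqP (hv _)) (eqP (gv _)).
have [g + <-] := tr_st i j.
have /subsetP sG : <<[set s; t]>>%g \subset Group gG.
  rewrite gen_subG; apply/subsetP => h; rewrite !inE => /orP[]/eqP ->.
    by apply/forallP => k; rewrite vs.
  by apply/forallP => k; rewrite vt.
by move=> /sG; rewrite inE => /forallP/(_ i)/eqP ->.
Qed.

Lemma fixed_sum0 v s t : d%:R != 0 :> F -> transitive_pair s t ->
  v *m disp s = 0 -> v *m disp t = 0 -> v *m J = 0 -> v = 0.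
Proof.
move=> d0 tr_st vs vt J0; apply/rowP => i; rewrite mxE.
have := const_of_fixed tr_st vs vt i => vE.
move/rowP/(_ i): J0; rewrite mulJE !mxE.
rewrite (eq_bigr (fun=> v 0 i)) => [|j _]; last by rewrite -vE.
by rewrite sumr_const card_ord -mulr_natl => /eqP; rewrite mulf_eq0 (negPf d0) => /eqP.
Qed.

End Disp.

(** * Positivity *)

Section Hermitian.
Variable d : nat.
Implicit Types (s t : 'S_d) (u v w : 'rV[algC]_d).
Local Notation J := (const_mx 1 : 'M[algC]_d).

Definition ip u v : algC := (u *m (map_mx Num.conj v)^T) 0 0.

Lemma ipE u v : ip u v = \sum_i u 0 i * (v 0 i)^*.
Proof. by rewrite /ip mxE; apply: eq_bigr => i _; rewrite !mxE. Qed.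

Lemma ipC u v : (ip u v)^* = ip v u.
Proof.
rewrite !ipE rmorph_sum; apply: eq_bigr => i _.
by rewrite rmorphM /= conjCK mulrC.
Qed.

Lemma ipDl u v w : ip (u + v) w = ip u w + ip v w.
Proof. by rewrite /ip mulmxDl mxE. Qed.

Lemma ipNl u w : ip (- u) w = - ip u w.
Proof. by rewrite /ip mulNmx mxE. Qed.

Lemma ipZl (a : algC) u w : ip (a *: u) w = a * ip u w.
Proof. by rewrite /ip -scalemxAl mxE. Qed.

Lemma ipDr u v w : ip w (u + v) = ip w u + ip w v.
Proof. by rewrite -ipC ipDl rmorphD /= !ipC. Qed.

Lemma ipNr u w : ip w (- u) = - ip w u.
Proof. by rewrite -ipC ipNl rmorphN /= !ipC. Qed.

Lemma ipZr (a : algC) u w : ip w (a *: u) = a^* * ip w u.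
Proof. by rewrite -ipC ipZl rmorphM /= !ipC. Qed.

Lemma ip0l w : ip 0 w = 0.
Proof. by rewrite /ip mul0mx mxE. Qed.

Lemma ip_ge0 v : 0 <= ip v v.
Proof. by rewrite ipE sumr_ge0 // => i _; rewrite mul_conjC_ge0. Qed.

Lemma ip_eq0 v : ip v v = 0 -> v = 0.
Proof.
rewrite ipE => /eqP; rewrite psumr_eq0 => [|i _]; last exact: mul_conjC_ge0.
move/allP => v0; apply/rowP => i; rewrite mxE.
by have := v0 i (mem_index_enum _); rewrite mul_conjC_eq0 => /eqP.
Qed.

Lemma ip_disp u v s : ip (u *m disp s) v = ip u (v *m disp s^-1%g).
Proof.
rewrite /ip -mulmxA map_mxM trmx_mul; congr ((_ *m (_ *m _)) 0 0).
by rewrite -tr_disp map_trmx trmxK unlock map_mxB map_mx1 map_perm_mx.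
Qed.

Lemma ip_J u v : ip (u *m J) v = ip u (v *m J).
Proof.
rewrite /ip -mulmxA map_mxM trmx_mul; congr ((_ *m (_ *m _)) 0 0).
by rewrite map_const_mx trmx_const rmorph1.
Qed.

(** Permutations preserve the norm, so twice the real part of the product of v - vs with v is the
    squared norm of v - vs. All positivity arguments rest on this. *)
Lemma ip_dispD v s :
  ip (v *m disp s) v + ip v (v *m disp s) = ip (v *m disp s) (v *m disp s).
Proof.
by rewrite [RHS]ip_disp -mulmxA -disp_sum mulmxDr ipDr [LHS]addrC -ip_disp.
Qed.

(** [v - v *m disp s] is the image of v under s, and s is unitary. *)
Lemma ip_disp_perm u v s :
  ip (u *m disp s) (v - v *m disp s) = - ip u (v *m disp s).
Proof.
rewrite ip_disp mulmxBl -mulmxA -disp_sum mulmxDr opprD addrCA subrr addr0.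
by rewrite ipNr.
Qed.

Lemma ip_disp_fixed u v s : v *m disp s = 0 -> ip (u *m disp s) v = 0.
Proof.
move=> /eqP; rewrite -mul_dispV0 => /eqP vs.
by rewrite ip_disp vs -ipC ip0l rmorph0.
Qed.

Lemma disp_eq0_of_ip v s : ip (v *m disp s) v = 0 -> v *m disp s = 0.
Proof.
by move=> h; apply: ip_eq0; rewrite -ip_dispD -[ip v _]ipC h rmorph0 addr0.
Qed.

Section Transitive.
Variables s t : 'S_d.
Hypotheses (d_gt0 : (0 < d)%N) (tr_st : transitive_pair s t).

Let d0 : d%:R != 0 :> algC.
Proof. by rewrite pnatr_eq0 -lt0n. Qed.

(** Pair the equation with v and add the complex conjugate: this gives a positive combination of
    three squared norms. Hence v is fixed by s and t and has sum 0, and transitivity makes it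
    zero. *)
Lemma posdef v (a b c : algC) : 0 < a -> 0 < b -> 0 < c ->
  v *m (a *: disp t + b *: disp s^-1%g + c *: J) = 0 -> v = 0.
Proof.
move=> a0 b0 c0 v0.
have e : a * ip (v *m disp t) v + b * ip (v *m disp s^-1%g) v +
         c * ip (v *m J) v = 0.
  by rewrite -!ipZl -!ipDl !scalemxAr -!mulmxDr v0 ip0l.
have eJ : ip (v *m J) v = d%:R^-1 * ip (v *m J) (v *m J).
  rewrite [in RHS]ip_J -mulmxA J_sqr -scalemxAr ipZr conjC_nat mulrA mulVf //.
  by rewrite mul1r ip_J.
have {}e : a * ip (v *m disp t) (v *m disp t) +
    b * ip (v *m disp s^-1%g) (v *m disp s^-1%g) +
    (c * d%:R^-1 *+ 2) * ip (v *m J) (v *m J) = 0.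
  rewrite -!ip_dispD -!(ipC _ v).
  have := congr1 Num.conj e; rewrite !rmorphD !rmorphM rmorph0 /=.
  rewrite (conj_Creal (gtr0_real a0)) (conj_Creal (gtr0_real b0)).
  rewrite (conj_Creal (gtr0_real c0)) => e'.
  rewrite -[RHS]addr0 -{1}e -e' !mulrDr mulr2n mulrDl.
  have -> : (ip (v *m J) v)^* = ip (v *m J) v by rewrite ipC ip_J.
  by rewrite -!mulrA -eJ; ring.
have sz (x y z : algC) : 0 <= x -> 0 <= y -> 0 <= z -> x + y + z = 0 ->
    [/\ x = 0, y = 0 & z = 0].
  move=> x0 y0 z0 /eqP; rewrite paddr_eq0 ?addr_ge0 // paddr_eq0 //.
  by case/andP => /andP[/eqP-> /eqP->] /eqP->.
have [] := sz _ _ _ _ _ _ e; rewrite ?mulr_ge0 ?ip_ge0 ?ltW //.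
  by rewrite pmulrn_lgt0 // mulr_gt0 // invr_gt0 ltr0n.
move=> /eqP; rewrite mulf_eq0 gt_eqF // => /eqP/ip_eq0 vt.
move=> /eqP; rewrite mulf_eq0 gt_eqF // => /eqP/ip_eq0/eqP.
rewrite mul_dispV0 => /eqP vs.
move=> /eqP; rewrite mulf_eq0 mulrn_eq0 mulf_eq0 invr_eq0 (negPf d0) (gt_eqF c0) /=.
by move=> /eqP/ip_eq0; apply: (fixed_sum0 d0 tr_st).
Qed.

End Transitive.
End Hermitian.

(** * Eigenvalues of the pencil *)

Lemma row_free_ker0 (F : fieldType) (k n : nat) (M : 'M[F]_(k, n)) :
  (forall v : 'rV_k, v *m M = 0 -> v = 0) -> row_free M.
Proof.
move=> kM; rewrite -kermx_eq0; apply/eqP/row_matrixP => i.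
by rewrite row0; apply: kM; rewrite -row_mul mulmx_ker row0.
Qed.

Section FixedRank.
Variables (F : fieldType) (d : nat).
Implicit Types s : 'S_d.

(** A fixed vector is constant on the cycles of s, so W factors through the incidence matrix of
    cycles and points. *)
Lemma rank_fixed (k : nat) (W : 'M[F]_(k, d)) s : W *m disp s = 0 ->
  (\rank W <= #|porbits s|)%N.
Proof.
move=> Ws.
have Wcst i j j' : j' \in porbit s j -> W i j' = W i j.
  have /eqP/mul_disp0P Wi : row i W *m disp s = 0 by rewrite -row_mul Ws row0.
  case/porbitP => n ->; elim: n => [|n IHn]; first by rewrite expg0 perm1.
  by rewrite expgSr permM -IHn; have := Wi ((s ^+ n)%g j); rewrite !mxE.
have [d0|d_gt0] := posnP d.
  by apply: leq_trans (rank_leq_col W) _; apply: leq_trans (leq0n _); rewrite leqn0 d0.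
(* The default is never taken on a cycle, which is nonempty. *)
pose rep (X : {set 'I_d}) : 'I_d := odflt (Ordinal d_gt0) [pick j in X].
pose W1 := \matrix_(i < k, j < #|porbits s|) W i (rep (enum_val j)).
pose W2 : 'M[F]_(#|porbits s|, d) :=
    \matrix_(i < #|porbits s|, j < d) (j \in (enum_val i : {set 'I_d}))%:R.
suff -> : W = W1 *m W2 by apply: mulmx_max_rank.
apply/matrixP => i j; rewrite mxE.
have jX : porbit s j \in porbits s by apply: imset_f.
rewrite (bigD1 (enum_rank_in jX (porbit s j))) //= big1 => [|k' ne].
  rewrite addr0 !mxE enum_rankK_in // porbit_id mulr1.
  rewrite /rep; case: pickP => [j' /Wcst //|/(_ j)].
  by rewrite porbit_id.
rewrite !mxE; case: (boolP (j \in _)) => [jk|_]; last by rewrite mulr0.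
case/eqP: ne; apply: enum_val_inj; rewrite enum_rankK_in //.
have /imsetP[j' _ kE] := enum_valP k'.
by rewrite kE in jk *; apply/eqP; rewrite eq_porbit_mem porbit_sym.
Qed.

(** The all-ones vector is also fixed but has sum d, so adjoining it to W raises the rank by one. *)
Lemma rank_fixed_sum0 (k : nat) (W : 'M[F]_(k, d)) s : d%:R != 0 :> F ->
  W *m disp s = 0 -> W *m (const_mx 1 : 'M_d) = 0 -> (\rank W < #|porbits s|)%N.
Proof.
move=> d0 Ws WJ.
pose u : 'rV[F]_d := const_mx 1.
have uJ : u *m (const_mx 1 : 'M_d) = d%:R *: u.
  apply/rowP => j; rewrite !mxE; under eq_bigr do rewrite !mxE mulr1.
  by rewrite sumr_const card_ord mulr1.
have us : u *m disp s = 0.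
  by apply/eqP/mul_disp0P => i; rewrite !mxE.
have : (\rank (W + u)%MS <= #|porbits s|)%N.
  rewrite addsmxE; apply: rank_fixed.
  by rewrite mul_col_mx Ws us col_mx0.
suff -> : \rank (W + u)%MS = (\rank W).+1 by [].
have Wu0 : (W :&: u)%MS = 0.
  apply/eqP/rowV0P => v; rewrite sub_capmx => /andP[/submxP[x ->] /sub_rVP[a xE]].
  have : x *m W *m (const_mx 1 : 'M_d) = 0 by rewrite -mulmxA WJ mulmx0.
  rewrite xE -scalemxAl uJ scalerA => /eqP.
  rewrite scaler_eq0 mulf_eq0 (negPf d0) orbF => /orP[/eqP->|/eqP->].
    by rewrite scale0r.
  by rewrite scaler0.
have d_gt0 : (0 < d)%N by rewrite lt0n; apply: contraNneq d0 => ->.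
have u0 : u != 0.
  by apply/eqP => /rowP/(_ (Ordinal d_gt0))/eqP; rewrite !mxE oner_eq0.
by rewrite mxrank_disjoint_sum // rank_rV u0 addn1.
Qed.

End FixedRank.

Lemma mulmx_eq0_rows (F : fieldType) (k n q : nat) (M : 'M[F]_(k, n))
    (A B : 'M[F]_(n, q)) :
  (forall v : 'rV_n, v *m A = 0 -> v *m B = 0) -> M *m A = 0 -> M *m B = 0.
Proof.
move=> AB MA; apply/row_matrixP => i; rewrite row_mul row0; apply: AB.
by rewrite -row_mul MA row0.
Qed.

Lemma cubic_eq0 (F : closedFieldType) (d : nat) (N : 'M[F]_d) :
    (forall v : 'rV_d, v *m N *m N = 0 -> v *m N = 0) ->
    (forall v : 'rV_d, v *m (N - 1%:M) *m (N - 1%:M) = 0 ->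
       v *m (N - 1%:M) = 0) ->
    (forall v : 'rV_d, v *m (N + 1%:M) *m (N + 1%:M) = 0 ->
       v *m (N + 1%:M) = 0) ->
    (forall a, eigenvalue N a -> a \in [:: 0; 1; -1]) ->
  N *m (N - 1%:M) *m (N + 1%:M) = 0.
Proof.
case: d N => [|d] N kN kN1 kNp1 ev; first exact: flatmx0.
pose phi := horner_mx N; pose p : {poly F} := 'X * ('X - 1) * ('X + 1).
have phiX : phi 'X = N by rewrite /phi horner_mx_X.
have phiM q r : phi (q * r) = phi q * phi r by apply: rmorphM.
have phiX1 : phi ('X - 1) = N - 1%:M.
  by rewrite -[RHS]/(N - 1) -phiX [LHS]rmorphB rmorph1.
have phiXp1 : phi ('X + 1) = N + 1%:M.
  by rewrite -[RHS]/(N + 1) -phiX [LHS]rmorphD rmorph1.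
have sq (a : {poly F}) : (forall v : 'rV_d.+1, v *m phi a *m phi a = 0 ->
    v *m phi a = 0) -> forall q, phi (q * a * a) = 0 -> phi (q * a) = 0.
  move=> ka q; rewrite -mulrA ![phi (q * _)]rmorphM; apply: mulmx_eq0_rows => v.
  by rewrite rmorphM mulmxA; apply: ka.
have sqX q : phi (q * 'X * 'X) = 0 -> phi (q * 'X) = 0.
  by apply: sq => v; rewrite phiX; apply: kN.
have sqX1 q : phi (q * ('X - 1) * ('X - 1)) = 0 -> phi (q * ('X - 1)) = 0.
  by apply: sq => v; rewrite phiX1; apply: kN1.
have sqXp1 q : phi (q * ('X + 1) * ('X + 1)) = 0 -> phi (q * ('X + 1)) = 0.
  by apply: sq => v; rewrite phiXp1; apply: kNp1.
have sqp q : phi (q * p * p) = 0 -> phi (q * p) = 0.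
  move=> h; have -> : q * p = q * ('X * ('X - 1)) * ('X + 1) by rewrite /p; ring.
  apply: sqXp1.
  have -> : q * ('X * ('X - 1)) * ('X + 1) * ('X + 1) =
    q * ('X * ('X + 1) ^+ 2) * ('X - 1) by ring.
  apply: sqX1.
  have -> : q * ('X * ('X + 1) ^+ 2) * ('X - 1) * ('X - 1) =
    q * (('X + 1) ^+ 2 * ('X - 1) ^+ 2) * 'X by ring.
  by apply: sqX; rewrite -[RHS]h; congr (phi _); rewrite /p; ring.
have phip k : phi (p ^+ k) = 0 -> phi p = 0.
  elim: k => [|[|k] IHk]; rewrite ?expr1 //.
    by rewrite expr0 [phi 1]rmorph1 => /eqP; rewrite oner_eq0.
  by rewrite 2!exprSr => /sqp; rewrite -exprSr.
suff : phi p = 0.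
  by rewrite /p !phiM phiX phiX1 phiXp1.
have [rs rsE] := closed_field_poly_normal (char_poly N).
rewrite (monicP (char_poly_monic N)) scale1r in rsE.
have rs_all : all [in [:: 0; 1; -1]] rs.
  apply/allP => a a_rs; apply: ev; rewrite eigenvalue_root_char rsE.
  by rewrite root_prod_XsubC.
have : \prod_(z <- rs) ('X - z%:P) %| p ^+ size rs.
  elim: rs rs_all {rsE} => [|z rs IHrs] /=; first by rewrite big_nil dvd1p.
  case/andP => z_in /IHrs dv; rewrite big_cons exprS dvdp_mul // dvdp_XsubCl.
  move: z_in; rewrite rootE !hornerE !inE => /or3P[]/eqP->.
  - by rewrite !mul0r.
  - by rewrite subrr mulr0 mul0r.
  - by rewrite addNr mulr0.
case/dvdpP => q qE; apply: (phip (size rs)).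
by rewrite qE phiM -rsE [phi (char_poly N)]Cayley_Hamilton mulr0.
Qed.

Section Eigenvalue.
Variables (d : nat) (s t : 'S_d).
Hypotheses (d_gt0 : (0 < d)%N) (tr_st : transitive_pair s t).
Local Notation S := (sym_part algC s t).
Local Notation C := (disp t - disp s^-1%g : 'M[algC]_d).
Local Notation J := (const_mx 1 : 'M[algC]_d).
Implicit Types v w : 'rV[algC]_d.

Let d0 : d%:R != 0 :> algC.
Proof. by rewrite pnatr_eq0 -lt0n. Qed.

Lemma sym_part_unit : S \in unitmx.
Proof.
rewrite -row_free_unit; apply: row_free_ker0 => v vS.
apply: (posdef d_gt0 tr_st (a := 1) (b := 1) (c := 1)) => //.
by rewrite !scale1r.
Qed.

Lemma mul_sym_part_sum0 v : v *m S *m J = 0 -> v *m J = 0.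
Proof.
rewrite -mulmxA /sym_part 2!mulmxDl !disp_J J_sqr !add0r -scalemxAr => /eqP.
by rewrite scaler_eq0 (negPf d0) => /eqP.
Qed.

Lemma antisym_part_J v : v *m C *m J = 0.
Proof. by rewrite -mulmxA mulmxBl !disp_J subr0 mulmx0. Qed.

(** With N = C S^-1 this says that vN = w and wN = 0 force w = 0: no Jordan block at 0. Since wC =
    0, t and s^-1 send w to the same vector, and vC is orthogonal to that vector. *)
Lemma jordan0 v w : v *m C = w *m S -> w *m C = 0 -> w = 0.
Proof.
move=> vC; rewrite mulmxBr => /eqP; rewrite subr_eq0 => /eqP wC.
have wJ : w *m J = 0 by apply: mul_sym_part_sum0; rewrite -vC antisym_part_J.
have q0 : w *m disp t = 0.
  have : ip (v *m C) (w - w *m disp t) = 0.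
    rewrite mulmxBr ipDl ipNl {2}wC !ip_disp_perm wC.
    by rewrite subrr.
  rewrite vC /sym_part 2!mulmxDr wJ -wC addr0 -mulr2n -scaler_nat ipZl => /eqP.
  rewrite mulf_eq0 pnatr_eq0 /= ipDr ipNr subr_eq0 => /eqP q.
  apply: ip_eq0; rewrite -{1}[RHS]addr0.
  have := ip_dispD w t; rewrite -[ip w _]ipC q ipC => /eqP.
  by rewrite -subr_eq0 addrK => /eqP ->; rewrite addr0.
by apply: (fixed_sum0 d0 tr_st) => //; apply/eqP; rewrite -mul_dispV0 -wC q0.
Qed.

(** No Jordan block at 1. Here w is fixed by s, and its displacement under t is a multiple of a
    displacement under s^-1, hence orthogonal to w, hence zero. *)
Lemma jordan1 v w : v *m C = (w + v) *m S -> w *m C = w *m S -> w = 0.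
Proof.
move=> vC wC; have wJ : w *m J = 0.
  by apply: mul_sym_part_sum0; rewrite -wC antisym_part_J.
have vJ : v *m J = 0.
  rewrite -[v](addKr w) mulmxDl mulNmx wJ oppr0 add0r.
  by apply: mul_sym_part_sum0; rewrite -vC antisym_part_J.
have ws : w *m disp s^-1%g = 0.
  move: wC; rewrite /sym_part mulmxBr 2!mulmxDr wJ addr0 => /addrI/eqP.
  rewrite eq_sym -subr_eq0 opprK -mulr2n -scaler_nat scaler_eq0 pnatr_eq0 /=.
  by move/eqP.
have wt : w *m disp t = - 2%:R *: (v *m disp s^-1%g).
  move: vC; rewrite /sym_part mulmxBr 2!mulmxDr !(mulmxDl w v) wJ vJ ws !addr0 add0r.
  move: (v *m _) (v *m _) (w *m _) => y x z E.
  rewrite -(addrK (x + y) z) addrA -E opprD addrA [x - y - x]addrAC subrr.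
  by rewrite sub0r scaleNr -opprD -mulr2n scaler_nat.
have {}wt : w *m disp t = 0.
  apply: disp_eq0_of_ip; rewrite wt ipZl ip_disp_fixed ?mulr0 //.
by apply: (fixed_sum0 d0 tr_st) => //; apply/eqP; rewrite -mul_dispV0 ws.
Qed.

(** The same argument at -1, with the roles of s and t exchanged. *)
Lemma jordanN1 v w : v *m C = (w - v) *m S -> w *m C = - (w *m S) -> w = 0.
Proof.
move=> vC wC; have wJ : w *m J = 0.
  apply: mul_sym_part_sum0; rewrite -[w *m S]opprK -wC mulNmx antisym_part_J.
  by rewrite oppr0.
have vJ : v *m J = 0.
  rewrite -[v](subKr w) mulmxBl wJ sub0r -mulNmx mulNmx.
  by rewrite mul_sym_part_sum0 ?oppr0 // -vC antisym_part_J.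
have wt : w *m disp t = 0.
  move/eqP: wC; rewrite /sym_part mulmxBr 2!mulmxDr wJ addr0 opprD => /eqP/addIr/eqP.
  rewrite -subr_eq0 opprK -mulr2n -scaler_nat scaler_eq0 pnatr_eq0 /=.
  by move/eqP.
have ws : w *m disp s^-1%g = 2%:R *: (v *m disp t).
  move: vC; rewrite /sym_part mulmxBr 2!mulmxDr !(mulmxBl w v) wJ vJ wt subr0 addr0 sub0r.
  move: (v *m _) (v *m _) (w *m _) => y x z E.
  by rewrite scaler_nat mulr2n -(subrK y z) -[z - y](addKr (- x)) opprK -E addrA subrK.
have {}ws : w *m disp s^-1%g = 0.
  by apply: disp_eq0_of_ip; rewrite ws ipZl ip_disp_fixed ?mulr0.
by apply: (fixed_sum0 d0 tr_st) => //; apply/eqP; rewrite -mul_dispV0 ws.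
Qed.

Lemma rank_ker_le (F : fieldType) (n r : nat) (A : 'M[F]_n) :
  (\rank (kermx A) <= r)%N -> (n <= \rank A + r)%N.
Proof. by rewrite mxrank_ker leq_subLR. Qed.

Hypothesis orbits_le :
  (#|porbits s| + #|porbits t| + #|porbits (s * t)%g| <= d)%N.

(** If t and s^-1 agree on v, then the image of v under s^-1 is fixed by st. *)
Lemma rank_antisym : (d <= \rank C + #|porbits (s * t)%g|)%N.
Proof.
apply: rank_ker_le; set W := kermx C.
have WC : W *m C = 0 by apply: mulmx_ker.
have -> : \rank W = \rank (W *m perm_mx s^-1%g).
  by rewrite mxrankMfree // row_free_unit unitmx_perm.
apply: rank_fixed; apply/eqP.
have -> : disp (s * t)%g = 1%:M - perm_mx s *m perm_mx t :> 'M[algC]_d.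
  by rewrite unlock perm_mxM.
rewrite mulmxBr mulmx1 mulmxA -[W *m _ *m _]mulmxA -perm_mxM mulVg perm_mx1 mulmx1.
rewrite -WC mulmxBr unlock !mulmxBr [in eqbRHS]opprB [in eqbRHS]addrC addrA.
by rewrite subrK.
Qed.

(** The kernel consists of vectors fixed by s with sum 0; the sum condition makes the inequality
    strict. *)
Lemma rank_sub_sym : (d < \rank (C - S)%R + #|porbits s|)%N.
Proof.
set W := kermx (C - S).
have WJ : W *m J = 0.
  apply: mulmx_eq0_rows (mulmx_ker _) => v; rewrite mulmxBr => /eqP.
  rewrite subr_eq0 => /eqP vC.
  by apply: mul_sym_part_sum0; rewrite -vC antisym_part_J.
have Ws : W *m disp s^-1%g = 0.
  have : W *m (C - S) = 0 by apply: mulmx_ker.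
  rewrite mulmxBr /sym_part mulmxBr 2!mulmxDr WJ addr0 opprD addrA.
  rewrite [_ - _ - W *m disp t]addrAC subrr sub0r.
  move/eqP; rewrite -opprD oppr_eq0 -mulr2n -scaler_nat scaler_eq0 pnatr_eq0 /=.
  by move/eqP.
have : (\rank W < #|porbits s|)%N by rewrite -porbitsV rank_fixed_sum0.
by rewrite mxrank_ker; lia.
Qed.

Lemma rank_add_sym : (d < \rank (C + S)%R + #|porbits t|)%N.
Proof.
set W := kermx (C + S).
have WJ : W *m J = 0.
  apply: mulmx_eq0_rows (mulmx_ker _) => v; rewrite mulmxDr => /eqP.
  rewrite addrC addr_eq0 => /eqP vS.
  by apply: mul_sym_part_sum0; rewrite vS mulNmx antisym_part_J oppr0.
have Wt : W *m disp t = 0.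
  have : W *m (C + S) = 0 by apply: mulmx_ker.
  rewrite mulmxDr /sym_part mulmxBr 2!mulmxDr WJ addr0 addrACA addNr addr0.
  move/eqP; rewrite -mulr2n -scaler_nat scaler_eq0 pnatr_eq0 /=.
  by move/eqP.
have : (\rank W < #|porbits t|)%N by rewrite rank_fixed_sum0.
by rewrite mxrank_ker; lia.
Qed.

Let N := C *m invmx S.

Let NS : N *m S = C.
Proof. by rewrite mulmxKV // sym_part_unit. Qed.

Let N1S : (N - 1%:M) *m S = C - S.
Proof. by rewrite mulmxBl NS mul1mx. Qed.

Let Np1S : (N + 1%:M) *m S = C + S.
Proof. by rewrite mulmxDl NS mul1mx. Qed.

Let rank_cubic : (\rank N + \rank (N - 1%:M)%R + \rank (N + 1%:M)%R > 2 * d)%N.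
Proof.
have rS (A : 'M_d) : \rank A = \rank (A *m S).
  by rewrite mxrankMfree // row_free_unit sym_part_unit.
rewrite (rS N) (rS (N - _)) (rS (N + _)) NS N1S Np1S.
by move: rank_antisym rank_sub_sym rank_add_sym orbits_le; lia.
Qed.

Let ker_sqr v : v *m N *m N = 0 -> v *m N = 0.
Proof.
move=> vNN; apply: (@jordan0 v); first by rewrite -mulmxA NS.
by rewrite -NS mulmxA vNN mul0mx.
Qed.

Let ker_sqr1 v :
  v *m (N - 1%:M) *m (N - 1%:M) = 0 -> v *m (N - 1%:M) = 0.
Proof.
move=> vNN; apply: (@jordan1 v).
  have -> : v *m (N - 1%:M) + v = v *m N by rewrite mulmxBr mulmx1 subrK.
  by rewrite -mulmxA NS.
apply/eqP; rewrite -subr_eq0 -mulmxBr -N1S mulmxA vNN mul0mx //.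
Qed.

Let ker_sqrN1 v :
  v *m (N + 1%:M) *m (N + 1%:M) = 0 -> v *m (N + 1%:M) = 0.
Proof.
move=> vNN; apply: (@jordanN1 v).
  have -> : v *m (N + 1%:M) - v = v *m N by rewrite mulmxDr mulmx1 addrK.
  by rewrite -mulmxA NS.
apply/eqP; rewrite -addr_eq0 -mulmxDr -Np1S mulmxA vNN mul0mx //.
Qed.

(** The pencil is singular at the eigenvalues of N. If these were all among 0, 1 and -1, then N (N -
    1) (N + 1) would vanish, and Sylvester's rank inequality would bound the sum of the three ranks
    by 2d, against [rank_cubic]. *)
Lemma pencil_eigen : exists2 a : algC,
  [&& a != 0, a != 1 & a != -1] & \det (pencil s t a) = 0.
Proof.
have [a /and3P[a0 a1 aN1] /eigenvalueP[v vN v0]] : exists2 a : algC,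
    [&& a != 0, a != 1 & a != -1] & eigenvalue N a; last first.
  exists a; first exact/and3P.
  apply/eqP/det0P; exists v => //.
  by rewrite mulmxBr -scalemxAr -NS mulmxA vN -scalemxAl subrr.
have [/hasP[a]|] := boolP (has [pred a | a \notin [:: 0; 1; -1]]
    (sval (closed_field_poly_normal (char_poly N)))).
  case: closed_field_poly_normal => rs /= rsE a_rs aN.
  exists a; first by move: aN; rewrite !inE !negb_or.
  rewrite eigenvalue_root_char rsE rootZ ?lead_coef_eq0 ?monic_neq0 ?char_poly_monic //.
  by rewrite root_prod_XsubC.
case: closed_field_poly_normal => rs /= rsE; rewrite -all_predC => /allP rs_all.
have nil : N *m (N - 1%:M) *m (N + 1%:M) = 0.
  apply: cubic_eq0 ker_sqr ker_sqr1 ker_sqrN1 _ => a.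
  rewrite eigenvalue_root_char rsE rootZ ?lead_coef_eq0 ?monic_neq0 ?char_poly_monic //.
  by rewrite root_prod_XsubC => /rs_all /=; rewrite negbK.
have := rank_cubic.
have := mxrank_mul_min N (N - 1%:M).
have := mxrank_mul_min (N *m (N - 1%:M)) (N + 1%:M).
rewrite nil mxrank0.
by move: (\rank _) (\rank _) (\rank _) (\rank _) => x y z w h1 h2 h3; exfalso; lia.
Qed.

End Eigenvalue.

(** * Chirality in characteristic 0 *)

Section NoCoincidence.
Variables (d : nat).
Implicit Types (s t : 'S_d) (h k e u : 'rV[algC]_d).

(* Both [h] and [k] have shape [r], but for the mirror image action in the case
   of [k]. If [r] is not real, then [h (disp t)] is orthogonal to all such [k],
   and so to [h] itself. *)
Lemma coincidence_fixed s t (r : algC) h k e u : r != 0 -> r != 1 ->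
    h *m disp t = r *: (h *m disp s^-1%g) ->
    k *m disp t^-1%g = r *: (k *m disp s) ->
    e *m disp s = 0 -> u *m disp t = 0 -> h = k + e - u ->
  h *m disp t = 0.
Proof.
move=> r0 r1 hE kE es ut hkE.
have es' : e *m disp s^-1%g = 0 by apply/eqP; rewrite mul_dispV0 es.
have hk : ip (h *m disp t) h = ip (h *m disp t) k.
  rewrite {2}hkE !ipDr ipNr (ip_disp_fixed _ ut) subr0 [in X in _ + X]hE ipZl.
  by rewrite (ip_disp_fixed _ es') mulr0 addr0.
have kk : r * ip (h *m disp t) k = r^* * ip (h *m disp t) k.
  by rewrite {1}ip_disp kE ipZr hE ipZl ip_disp invgK mulrCA.
have [rR|rC] := eqVneq r r^*; last first.
  apply: disp_eq0_of_ip; rewrite hk; apply/eqP; move/eqP: kk.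
  by rewrite -subr_eq0 -mulrBl mulf_eq0 subr_eq0 (negPf rC).
(* For real r and B the displacement of h under s^-1, the two norm identities give r |B|^2 = r^2
   |B|^2, so B = 0. *)
have n1 := ip_dispD h t; have n2 := ip_dispD h s^-1%g.
have hB0 : h *m disp s^-1%g = 0.
  apply: ip_eq0; move: n1; rewrite !hE !(ipZl, ipZr) -!rR -mulrDr n2 => /eqP.
  rewrite eq_sym -subr_eq0 -{2}[r * ip _ _]mul1r -mulrBl mulf_eq0 subr_eq0 (negPf r1).
  by rewrite mulf_eq0 (negPf r0) => /eqP.
by rewrite hE hB0 scaler0.
Qed.

End NoCoincidence.

(** The linear system, in unknowns h, k, u, for a coincidence of the action with its mirror image;
    the transposed pencil is that of the inverses of s and t. In matrix form, the absence of
    solutions becomes a nonzero minor, polynomial in a. *)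
Definition coincidence_mx (R : pzRingType) (d : nat) (s t : 'S_d) (a : R) :
    'M[R]_(d + (d + d), d + (d + (d + d))) :=
  col_mx (row_mx (pencil s t a) (row_mx 0 (row_mx 0 (disp s^-1%g))))
 (col_mx (row_mx 0 (row_mx (pencil s t a)^T (row_mx 0 (- disp s^-1%g))))
         (row_mx 0 (row_mx 0 (row_mx (disp t + const_mx 1) (disp s^-1%g))))).

Lemma coincidence_mxE (R : pzRingType) (d : nat) (s t : 'S_d) (a : R)
    (h k u : 'rV[R]_d) :
  row_mx h (row_mx k u) *m coincidence_mx s t a =
  row_mx (h *m pencil s t a) (row_mx (k *m (pencil s t a)^T)
    (row_mx (u *m (disp t + const_mx 1)) ((h - k + u) *m disp s^-1%g))).
Proof.
rewrite !mul_row_col !mul_mx_row !add_row_mx !mulmx0 !addr0 !add0r.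
by rewrite mulmxN addrA -mulmxBl -mulmxDl.
Qed.

Lemma coincidence_mx_free (d : nat) (s t : 'S_d) (a : algC) :
    (0 < d)%N -> transitive_pair s t -> a != 0 -> a != 1 -> a != -1 ->
  row_free (coincidence_mx s t a).
Proof.
move=> d_gt0 tr_st a0 a1 aN1; apply: row_free_ker0 => v.
have d0 : d%:R != 0 :> algC by rewrite pnatr_eq0 -lt0n.
rewrite -(hsubmxK v) -(hsubmxK (rsubmx v)).
move: (lsubmx v) (lsubmx (rsubmx v)) (rsubmx (rsubmx v)) => h k u.
rewrite coincidence_mxE -!row_mx0.
move=> /eq_row_mx[hP /eq_row_mx[kP /eq_row_mx[uP eP]]].
have uJ : u *m (const_mx 1 : 'M_d) = 0.
  have : u *m (disp t + const_mx 1) *m (const_mx 1 : 'M_d) = 0.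
    by rewrite uP mul0mx.
  rewrite -mulmxA mulmxDl disp_J J_sqr add0r -scalemxAr => /eqP.
  by rewrite scaler_eq0 (negPf d0) => /eqP.
have ut : u *m disp t = 0 by move: uP; rewrite mulmxDr uJ addr0.
have [hJ hE] := (pencilP h s t a0 d0).1 hP.
have [kJ kE] : k *m (const_mx 1 : 'M_d) = 0 /\
    (1 - a) *: (k *m disp t^-1%g) = (1 + a) *: (k *m disp s).
  by have := (pencilP k s^-1 t^-1 a0 d0).1; rewrite invgK -tr_pencil; apply.
have es : (h - k + u) *m disp s = 0 by apply/eqP; rewrite -mul_dispV0 eP.
have a1' : 1 - a != 0 by rewrite subr_eq0 eq_sym.
(* The common shape of h and k; it is nonzero because a is not -1, and differs from 1 because a is
   not 0. *)
pose r := (1 - a)^-1 * (1 + a).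
have r0 : r != 0.
  by rewrite mulf_neq0 ?invr_eq0 // addrC addr_eq0.
have r1 : r != 1.
  rewrite -(inj_eq (mulfI a1')) mulVKf // mulr1 -subr_eq0.
  have -> : 1 + a - (1 - a) = a *+ 2 by ring.
  by rewrite mulrn_eq0.
have scale x y : (1 - a) *: x = (1 + a) *: y -> x = r *: y :> 'rV[algC]_d.
  by move=> xy; rewrite -scalerA -xy scalerA mulVf // scale1r.
have h0 : h = 0.
  have ht : h *m disp t = 0.
    apply: (coincidence_fixed r0 r1 (scale _ _ hE) (scale _ _ kE) es ut).
    by rewrite addrA subrKC addrK.
  apply: (fixed_sum0 d0 tr_st) => //; apply/eqP; rewrite -mul_dispV0.
  move/eqP: hE; rewrite ht scaler0 eq_sym scaler_eq0 addrC addr_eq0.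
  by rewrite (negPf aN1).
have k0 : k = 0.
  have kt : k *m disp t^-1%g = 0.
    (* The mirrored situation: s and t inverted, h and k exchanged. *)
    apply: (@coincidence_fixed _ s^-1%g t^-1%g r k h (- (h - k + u)) (- u)) => //.
    - by rewrite invgK; apply: scale.
    - by rewrite invgK; apply: scale.
    - by rewrite mulNmx eP oppr0.
    - by apply/eqP; rewrite mul_dispV0 mulNmx ut oppr0.
    - by rewrite opprK h0 sub0r add0r opprD opprK subrK.
  apply: (fixed_sum0 d0 tr_st) => //; apply/eqP; last by rewrite -mul_dispV0 kt.
  move/eqP: kE; rewrite kt scaler0 eq_sym scaler_eq0 addrC addr_eq0.
  by rewrite (negPf aN1).
have u0 : u = 0.
  by apply: (fixed_sum0 d0 tr_st) => //; rewrite -es h0 k0 subrr add0r.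
by rewrite h0 k0 u0 !row_mx0.
Qed.

(** * Reduction modulo p *)

Section Reduction.
Variables (d : nat) (s t : 'S_d).

Lemma map_disp (R R' : pzRingType) (f : {rmorphism R -> R'}) (u : 'S_d) :
  map_mx f (disp u) = disp u.
Proof. by rewrite unlock map_mxB map_mx1 map_perm_mx. Qed.

Lemma map_pencil (R R' : pzRingType) (f : {rmorphism R -> R'}) (a : R) :
  map_mx f (pencil s t a) = pencil s t (f a).
Proof.
rewrite /pencil /sym_part map_mxB map_mxB map_mxZ 2!map_mxD !map_disp.
by rewrite map_const_mx /= rmorph1.
Qed.

Lemma map_coincidence_mx (R R' : pzRingType) (f : {rmorphism R -> R'}) (a : R) :
  map_mx f (coincidence_mx s t a) = coincidence_mx s t (f a).
Proof.
rewrite !map_col_mx !map_row_mx !map_mx0 -map_trmx map_pencil map_mxN map_mxD.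
by rewrite !map_disp map_const_mx /= rmorph1.
Qed.

Hypotheses (d_gt0 : (0 < d)%N) (tr_st : transitive_pair s t).
Hypothesis orbits_le :
  (#|porbits s| + #|porbits t| + #|porbits (s * t)%g| <= d)%N.

(** At a = 2 the pencil is minus the sum of [disp t], three times [disp s^-1] and twice the all-ones
    matrix, which is invertible by [posdef]. *)
Lemma det_pencil_neq0 : \det (pencil s t ('X : {poly int})) != 0.
Proof.
pose f := horner_eval (2%:R : algC) \o map_poly intr : {poly int} -> algC.
have : \det (map_mx f (pencil s t ('X : {poly int}))) != 0.
  rewrite map_pencil /= map_polyX /horner_eval hornerX.
  rewrite -unitfE -unitmxE -row_free_unit; apply: row_free_ker0 => v v0.
  apply: (posdef d_gt0 tr_st (a := 1) (b := 3%:R) (c := 2%:R)); rewrite ?ltr0n //.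
  rewrite -[LHS]opprK; apply/eqP; rewrite oppr_eq0 -mulmxN; apply/eqP.
  rewrite -[RHS]v0; congr (_ *m _); rewrite /pencil /sym_part.
  set x := disp t; set y := disp _; set z := const_mx 1.
  by clearbody x y z; apply/matrixP => i j; rewrite !mxE; ring.
by apply: contraNneq; rewrite det_map_mx => ->; rewrite rmorph0.
Qed.

Lemma good_prime (b : nat) : exists2 p : nat, prime p /\ (b < p)%N &
  exists2 a : 'F_p, [&& a != 0, a != 1 & a != -1] &
    \det (pencil s t a) = 0 /\ row_free (coincidence_mx s t a).
Proof.
have [c /and3P[c0 c1 cN1] cP] := pencil_eigen d_gt0 tr_st orbits_le.
have := coincidence_mx_free d_gt0 tr_st c0 c1 cN1.
rewrite /row_free -mxrank_tr => full_c.
pose D := \det (pencil s t ('X : {poly int})).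
(* [g] selects a maximal minor of the coincidence matrix that is nonzero at c. The other factors of
   [m] below keep the root modulo p away from 0, 1 and -1. *)
pose g := fullrankfun full_c.
pose m0 := \det (rowsub g (coincidence_mx s t ('X : {poly int}))^T).
pose m := m0 * 'X * ('X - 1) * ('X + 1).
pose f (F : comNzRingType) (x : F) : {rmorphism {poly int} -> F} :=
  horner_eval x \o map_poly intr.
have fX (F : comNzRingType) (x : F) : f F x 'X = x.
  by rewrite /f /= map_polyX /horner_eval hornerX.
have fD (F : comNzRingType) (x : F) : f F x D = \det (pencil s t x).
  by rewrite -det_map_mx map_pencil [f _ _ _]fX.
have fm (F : comNzRingType) (x : F) : f F x m =
    \det (rowsub g (coincidence_mx s t x)^T) * x * (x - 1) * (x + 1).
  rewrite !rmorphM rmorphB rmorphD rmorph1 fX; congr (_ * _ * _ * _).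
  by rewrite -det_map_mx map_mxsub -map_trmx map_coincidence_mx [f _ _ _]fX.
have rf (F : comNzRingType) (x : F) (q : {poly int}) :
    root (map_poly intr q) x = (f F x q == 0).
  by [].
have [||p p_b [a]] := @root_mod_prime D m c b det_pencil_neq0.
- by rewrite rf fD cP.
- rewrite rf fm !mulf_neq0 // ?subr_eq0 ?addr_eq0 //.
  by have := fullrowsub_unit full_c; rewrite unitmxE unitfE.
rewrite !rf fD fm => /eqP aD; rewrite !mulf_eq0 !negb_or subr_eq0 addr_eq0.
case/andP => /andP[/andP[am a0] a1] aN1.
exists p => //; exists a; first exact/and3P.
split=> //; apply: row_free_ker0 => v /(congr1 trmx).
rewrite trmx_mul trmx0 => va.
have : rowsub g (coincidence_mx s t a)^T *m v^T = 0.
  by rewrite mul_rowsub_mx va; apply/matrixP => i j; rewrite !mxE.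
move=> /(congr1 (mulmx (invmx (rowsub g (coincidence_mx s t a)^T)))).
rewrite mulKmx ?unitmxE ?unitfE // mulmx0 => /(congr1 trmx).
by rewrite trmxK trmx0.
Qed.

End Reduction.

(** * Affine groups and their mirror images *)

Lemma gen_ind (gT : finGroupType) (A : {set gT}) (P : gT -> Prop) :
    P 1%g -> (forall x y, x \in <<A>>%g -> y \in A -> P x -> P (x * y)%g) ->
  forall x, x \in <<A>>%g -> P x.
Proof.
move=> P1 PM x /gen_prodgP[n [c cA ->{x}]].
elim: n c cA => [|n IHn] c cA; first by rewrite big_ord0.
rewrite big_ord_recr /=; apply: PM => //; last by apply: IHn => i; apply: cA.
by apply: group_prod => i _; apply/mem_gen/cA.
Qed.

Section Affine.
Variables (F : finFieldType) (d : nat).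
Local Notation V := 'rV[F]_d.
Implicit Types (g : 'S_d) (c h v : V).

Lemma aff_inj g c : injective (fun v : V => v *m perm_mx g + c).
Proof.
move=> v w /addIr /(congr1 (mulmx^~ (perm_mx g^-1%g))).
by rewrite -!mulmxA -perm_mxM mulgV perm_mx1 !mulmx1.
Qed.

Definition aff g c : {perm V} := perm (@aff_inj g c).

Lemma affM g c g' c' :
  (aff g c * aff g' c')%g = aff (g * g')%g (c *m perm_mx g' + c').
Proof.
by apply/permP => v; rewrite permM !permE perm_mxM mulmxDl mulmxA addrA.
Qed.

Lemma aff1 : aff 1%g 0 = 1%g.
Proof. by apply/permP => v; rewrite permE perm1 perm_mx1 mulmx1 addr0. Qed.

Lemma affV g c : (aff g c)^-1%g = aff g^-1%g (- (c *m perm_mx g^-1%g)).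
Proof. by apply/eqP; rewrite eq_invg_mul affM mulgV subrr aff1. Qed.

Lemma aff_trans_inj : injective (aff 1%g).
Proof.
by move=> c c' /permP/(_ 0); rewrite !permE !mul0mx !add0r.
Qed.

(** The affine map with linear part g that fixes h. *)
Definition rot h g := aff g (h *m disp g).

Lemma rotM h g g' : (rot h g * rot h g')%g = rot h (g * g')%g.
Proof.
rewrite /rot affM; congr (aff _ _); rewrite unlock !mulmxBr !mulmx1 mulmxBl.
by rewrite -mulmxA -perm_mxM addrC addrA subrK.
Qed.

Lemma rot1 h : rot h 1%g = 1%g.
Proof. by rewrite /rot unlock perm_mx1 subrr mulmx0 aff1. Qed.

Lemma rotV h g : (rot h g)^-1%g = rot h g^-1%g.
Proof. by apply/eqP; rewrite eq_invg_mul rotM mulgV rot1. Qed.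

Lemma rotX h g n : (rot h g ^+ n)%g = rot h (g ^+ n)%g.
Proof.
by elim: n => [|n IHn]; rewrite ?expg0 ?rot1 // !expgS IHn rotM.
Qed.

Lemma rot_eq1 h g : (rot h g == 1%g) = (g == 1%g).
Proof.
apply/eqP/eqP => [/permP r1|->]; last exact: rot1.
have gE v : v *m perm_mx g = v.
  have := r1 (v + h); rewrite permE perm1 mulmxDl unlock mulmxBr mulmx1.
  by rewrite -addrA subrKC => /addIr.
apply/permP => i; rewrite perm1; have /rowP/(_ (g i)) := gE (delta_mx 0 i).
rewrite -rowE !mxE !eqxx /= => /eqP.
by case: (g i =P i) => // _; rewrite oner_eq0.
Qed.

Lemma order_rot h g : #[rot h g]%g = #[g]%g.
Proof.
apply/eqP; rewrite eqn_dvd !order_dvdn rotX expg_order rot1 eqxx /=.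
by rewrite -(rot_eq1 h) -rotX expg_order.
Qed.

Lemma rot_mul h k g g' : k *m disp (g * g')%g = h *m disp g' ->
  (rot 0 g * rot h g')%g = rot k (g * g')%g.
Proof. by move=> kE; rewrite /rot affM kE mul0mx mul0mx add0r. Qed.

End Affine.

(** How the defect c' - cL of a pair of translation parts changes when the pair of affine maps is
    multiplied on the right by another, with L transported accordingly. *)
Lemma averaging_step (R : pzRingType) (d : nat) (c c' b b' : 'rV[R]_d)
    (L : 'M[R]_d) (k k' : 'S_d) :
  c' *m perm_mx k' + b' -
    (c *m perm_mx k + b) *m (perm_mx k^-1%g *m L *m perm_mx k') =
  (c' - c *m L) *m perm_mx k' + b' - b *m (perm_mx k^-1%g *m L *m perm_mx k').
Proof.
rewrite mulmxDl opprD addrA mulmxBl; congr (_ - _); rewrite addrAC.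
congr (_ - _ + _); rewrite !mulmxA -[_ *m perm_mx k *m _]mulmxA.
by rewrite -perm_mxM mulgV perm_mx1 mulmx1.
Qed.

(** Subtract the mean; constant vectors have no displacement. *)
Lemma sum0_normalize (F : fieldType) (d : nat) (v : 'rV[F]_d) :
    d%:R != 0 :> F ->
  exists2 v0 : 'rV[F]_d, v0 *m (const_mx 1 : 'M_d) = 0 &
    forall g, v0 *m disp g = v *m disp g.
Proof.
move=> d0; exists (v - d%:R^-1 *: (v *m (const_mx 1 : 'M_d))) => [|g].
  rewrite mulmxBl -scalemxAl -mulmxA J_sqr -scalemxAr scalerA mulVf // scale1r.
  by rewrite subrr.
by rewrite mulmxBl -scalemxAl -mulmxA J_disp mulmx0 scaler0 subr0.
Qed.

Lemma natr_Fp_neq0 p n : prime p -> (0 < n < p)%N -> n%:R != 0 :> 'F_p.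
Proof.
move=> p_pr /andP[n0 np]; rewrite -(dvdn_pcharf (pchar_Fp p_pr)).
by apply/negP => /(dvdn_leq n0); rewrite leqNgt np.
Qed.

Section Mirror.
Variables (p d : nat) (s t : 'S_d) (a : 'F_p) (h : 'rV['F_p]_d).
Hypotheses (p_pr : prime p) (d_bnd : (0 < d < p)%N).
Hypothesis perms_lt_p : (#|{: 'S_d * 'S_d}| < p)%N.
Hypothesis a0 : a != 0.
Hypotheses (h0 : h != 0) (hP : h *m pencil s t a = 0).
Hypothesis free : row_free (coincidence_mx s t a).
Local Notation V := 'rV['F_p]_d.

(** An element (1, g) with g nontrivial comes from a word that is trivial in the affine group while
    its mirror image is not. *)
Definition mirror_group : {set {perm V} * {perm V}} :=
  <<[set (rot 0 s, (rot 0 s)^-1%g); (rot h t, (rot h t)^-1%g)]>>%g.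
Local Notation G := mirror_group.

Definition mirror_linear : {set 'S_d * 'S_d} :=
  <<[set (s, s^-1%g); (t, t^-1%g)]>>%g.
Local Notation Q := mirror_linear.

Canonical mirror_group_group := [group of G].
Canonical mirror_linear_group := [group of Q].

Lemma mirror_s : (aff s (0 : V), aff s^-1%g (0 : V)) \in G.
Proof.
have <- : (rot 0 s, (rot 0 s)^-1%g) = (aff s (0 : V), aff s^-1%g (0 : V)).
  by rewrite rotV /rot !mul0mx.
exact/mem_gen/set21.
Qed.

Lemma mirror_t :
  (aff t (h *m disp t), aff t^-1%g (h *m disp t^-1%g)) \in G.
Proof.
rewrite -/(rot h t) -/(rot h t^-1) -rotV; exact/mem_gen/set22.
Qed.

Lemma mirror_lift q : q \in Q ->
  exists c : V * V, (aff q.1 c.1, aff q.2 c.2) \in G.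
Proof.
move: q; apply: gen_ind => [|q r _ rQ [c cG]].
  by exists (0, 0); rewrite !aff1; apply: group1.
have [c' c'G] : exists c : V * V, (aff r.1 c.1, aff r.2 c.2) \in G.
  move: rQ; rewrite !inE => /orP[]/eqP->; first by exists (0, 0); apply: mirror_s.
  by exists (h *m disp t, h *m disp t^-1%g); apply: mirror_t.
have := groupM cG c'G.
by exists (c.1 *m perm_mx r.1 + c'.1, c.2 *m perm_mx r.2 + c'.2); rewrite -!affM.
Qed.

(** Over a prime field scalars are multiples of 1, so an additive relation is a linear one. A
    pseudo-inverse of the list of all first components extends the resulting partial function to the
    whole space. *)
Lemma additive_graph_linear (n : nat) (T : pred ('rV['F_p]_n * 'rV['F_p]_n)) :
    T (0, 0) ->
    (forall x y, T x -> T y -> T (x.1 + y.1, x.2 + y.2)) ->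
    (forall y, T (0, y) -> y = 0) ->
  exists L : 'M['F_p]_n, forall x, T x -> x.1 *m L = x.2.
Proof.
move=> T0 TD Tfun.
pose M1 := \matrix_(i < #|T|) (enum_val i).1.
pose M2 := \matrix_(i < #|T|) (enum_val i).2.
have TZ x (b : 'F_p) : T x -> T (b *: x.1, b *: x.2).
  move=> xT; rewrite -(natr_Zp b) !scaler_nat.
  elim: (b : nat) => [|k IHk]; first by rewrite !mulr0n.
  by rewrite !mulrS; apply: (TD x (_, _)).
have TM (c : 'rV_#|T|) : T (c *m M1, c *m M2).
  rewrite !mulmx_sum_row.
  apply: (big_ind2 (fun x y => T (x, y))) => // [x1 x2 y1 y2 xT yT|i _].
    exact: (TD (_, _) (_, _)).
  by rewrite !rowK; apply/TZ/(enum_valP i).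
have kerM (c : 'rV_#|T|) : c *m M1 = 0 -> c *m M2 = 0.
  by move=> c0; apply: Tfun; rewrite -{1}c0; apply: TM.
exists (pinvmx M1 *m M2) => x xT.
have xE : x.1 = delta_mx 0 (enum_rank_in xT x) *m M1.
  by rewrite -rowE rowK enum_rankK_in.
have -> : x.2 = delta_mx 0 (enum_rank_in xT x) *m M2.
  by rewrite -rowE rowK enum_rankK_in.
rewrite xE mulmxA; apply/eqP; rewrite -subr_eq0 -mulmxBl; apply/eqP/kerM.
by rewrite mulmxBl mulmxKpV ?submxMl // subrr.
Qed.

(* Otherwise, on the pairs of translations in [G], the second component would be a
   linear function of the first, and averaging over the linear parts would turn
   that function into an affine map intertwining the two actions. It maps the centres 0 and [h] of the two rotations to centres of
   their inverses, which [free] excludes. *)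
Lemma mirror_kernel : exists2 c : V, (1%g, aff 1%g c) \in G & c != 0.
Proof.
apply/exists_inP; apply: contraT; rewrite negb_exists_in => /forall_inP ker1.
have {}ker1 c : (1%g, aff 1%g c) \in G -> c = 0.
  by move/ker1; rewrite negbK => /eqP.
pose T (x : V * V) := (aff 1 x.1, aff 1 x.2) \in G.
have [L LT] : exists L : 'M_d, forall x, T x -> x.1 *m L = x.2.
  apply: additive_graph_linear => [|x y|y]; rewrite /T /=.
  - by rewrite !aff1 group1.
  - move=> xT yT; have := groupM xT yT.
    congr (_ \in G); congr (_, _); rewrite /= affM mulg1 perm_mx1 mulmx1 //.
  - by rewrite aff1 => /ker1.
have [lift liftP] : exists lift : 'S_d * 'S_d -> V * V, forall q, q \in Q ->
    (aff q.1 (lift q).1, aff q.2 (lift q).2) \in G.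
  exists (fun q =>
    odflt (0, 0) [pick c : V * V | (aff q.1 c.1, aff q.2 c.2) \in G]) => q qQ.
  case: pickP => [c //|no].
  by have [c] := mirror_lift qQ; rewrite no.
have [Lq LqE] : exists Lq : 'S_d * 'S_d -> 'M['F_p]_d,
    forall q, Lq q = perm_mx q.1^-1%g *m L *m perm_mx q.2 by eexists.
(* Two lifts of q differ by a pair of translations in G, on which L computes the second component
   from the first; so the defect does not depend on the lift. *)
have indep q c : q \in Q -> (aff q.1 c.1, aff q.2 c.2) \in G ->
    (lift q).2 - (lift q).1 *m Lq q = c.2 - c.1 *m Lq q.
  move=> qQ cG; have := groupM (liftP q qQ) (groupVr cG).
  have -> : ((aff q.1 (lift q).1, aff q.2 (lift q).2) *
             (aff q.1 c.1, aff q.2 c.2)^-1)%g =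
    (aff 1%g (((lift q).1 - c.1) *m perm_mx q.1^-1%g),
     aff 1%g (((lift q).2 - c.2) *m perm_mx q.2^-1%g)).
    by congr (_, _); rewrite /= affV affM mulgV mulmxBl.
  move=> dG; have /= dL := LT (_, _) dG.
  have dE : ((lift q).1 - c.1) *m Lq q = (lift q).2 - c.2.
    by rewrite LqE !mulmxA dL -mulmxA -perm_mxM mulVg perm_mx1 mulmx1.
  rewrite -[X in X - _](subrK c.2) -dE mulmxBl addrAC.
  by rewrite [_ - _ - (lift q).1 *m _]addrAC subrr sub0r addrC.
(* The order of Q is below p, so averaging over Q is possible, as in Maschke's theorem. *)
have Q0 : #|Q|%:R != 0 :> 'F_p.
  apply: natr_Fp_neq0; rewrite // cardG_gt0 /=.
  by apply: leq_ltn_trans perms_lt_p; apply: max_card.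
have [Lb LbE'] : exists Lb, #|Q|%:R *: Lb = \sum_(q in Q) Lq q.
  by exists (#|Q|%:R^-1 *: \sum_(q in Q) Lq q); rewrite scalerA divff // scale1r.
have [e eE'] : exists e : V,
    #|Q|%:R *: e = \sum_(q in Q) ((lift q).2 - (lift q).1 *m Lq q).
  exists (#|Q|%:R^-1 *: \sum_(q in Q) ((lift q).2 - (lift q).1 *m Lq q)).
  by rewrite scalerA divff // scale1r.
have LqM q k : Lq (q * k)%g = perm_mx k.1^-1%g *m Lq q *m perm_mx k.2.
  by rewrite !LqE !mulmxA -perm_mxM -invMg -!mulmxA -perm_mxM.
have LbE k : k \in Q -> Lb = perm_mx k.1^-1%g *m Lb *m perm_mx k.2.
  move=> kQ; apply: (scalerI Q0); rewrite scalemxAl scalemxAr LbE'.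
  rewrite mulmx_sumr mulmx_suml [LHS](reindex_inj (mulIg k)).
  apply: eq_big => [q|q _]; first by rewrite groupMr.
  exact: LqM.
(* Together with [LbE], this says that v |-> v Lb + e intertwines the two affine actions. *)
have eE k c : k \in Q -> (aff k.1 c.1, aff k.2 c.2) \in G ->
    e = e *m perm_mx k.2 + c.2 - c.1 *m Lb.
  move=> kQ cG; apply: (scalerI Q0).
  rewrite scalerBr scalerDr scalemxAl scalemxAr eE' LbE' scaler_nat -sumr_const.
  rewrite mulmx_suml mulmx_sumr -big_split /=.
  rewrite [X in _ = _ - X](reindex_inj (mulIg k)) [LHS](reindex_inj (mulIg k)) /=.
  rewrite [X in _ = _ - X](eq_bigl _ _ (fun q => groupMr q kQ)).
  rewrite [LHS](eq_bigl _ _ (fun q => groupMr q kQ)) -sumrB.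
  apply: eq_bigr => q qQ; have qkG := groupM (liftP q qQ) cG.
  rewrite (indep _ ((lift q).1 *m perm_mx k.1 + c.1,
                    (lift q).2 *m perm_mx k.2 + c.2)) ?groupM //.
    by rewrite LqM; apply: averaging_step.
  by rewrite /= -!affM.
have d0 := natr_Fp_neq0 p_pr d_bnd.
have [hJ hE] := (pencilP h s t a0 d0).1 hP.
have disp_Lb g : (g, g^-1%g) \in Q -> disp g *m Lb = Lb *m disp g^-1%g.
  move=> gQ; have gLb : perm_mx g *m Lb = Lb *m perm_mx g^-1%g.
    rewrite {1}(LbE _ gQ) !mulmxA -perm_mxM mulgV perm_mx1 mul1mx.
    by [].
  by rewrite unlock mulmxBl mulmxBr mul1mx mulmx1 gLb.
have sQ : (s, s^-1%g) \in Q by apply/mem_gen/set21.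
have tQ : (t, t^-1%g) \in Q by apply/mem_gen/set22.
have sVQ : (s^-1%g, s^-1%g^-1%g) \in Q by have := groupVr sQ.
have e_s : e *m disp s^-1%g = 0.
  have /= eEs := eE (s, s^-1%g) (0, 0) sQ mirror_s.
  apply/eqP; rewrite unlock mulmxBr mulmx1 {1}eEs mul0mx subr0 addr0.
  by rewrite subrr.
have [k kE] : exists k, k = h *m Lb by eexists.
(* The intertwiner sends 0 to e and h to k + e. These are fixed by the inverse rotations about 0 and
   h, so e is fixed by s and u by t. *)
have [u uE] : exists u, u = k + e - h by eexists.
have k_t : k *m disp t^-1%g = h *m disp t *m Lb.
  by rewrite kE -[RHS]mulmxA (disp_Lb _ tQ) mulmxA.
have k_s : k *m disp s = h *m disp s^-1%g *m Lb.
  by rewrite kE -[RHS]mulmxA (disp_Lb _ sVQ) invgK mulmxA.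
have u_t : u *m disp t = 0.
  apply/eqP; rewrite -mul_dispV0 uE mulmxBl mulmxDl k_t.
  have /= eEt := eE (t, t^-1%g) (_, _) tQ mirror_t.
  have -> : e *m disp t^-1%g = h *m disp t^-1%g - h *m disp t *m Lb.
    rewrite {1}unlock mulmxBr mulmx1 {1}eEt addrAC.
    by rewrite [X in X - _ - _]addrC addrK.
  by rewrite subrKC subrr.
have [k0 k0J k0E] := sum0_normalize k d0.
have [u0 u0J u0E] := sum0_normalize u d0.
suff : row_mx h (row_mx k0 u0) = 0.
  by rewrite -row_mx0 => /eq_row_mx[h00 _]; move: h0; rewrite h00 eqxx.
apply: (row_free_inj free); rewrite mul0mx coincidence_mxE hP -!row_mx0.
congr (row_mx _ (row_mx _ (row_mx _ _))).
- rewrite tr_pencil; apply: (pencilP k0 s^-1 t^-1 a0 d0).2; split; first exact: k0J.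
  by rewrite invgK (k0E t^-1%g) (k0E s) k_t k_s [LHS]scalemxAl hE -scalemxAl.
- by rewrite mulmxDr u0J addr0 u0E.
rewrite mulmxDl mulmxBl k0E u0E -mulmxBl -mulmxDl -e_s; congr (_ *m _).
by rewrite uE addrC addrA subrK addrAC subrr add0r.
Qed.

End Mirror.

Lemma order_aff_trans (p d : nat) (c : 'rV['F_p]_d) : prime p -> c != 0 ->
  #[aff 1%g c]%g = p.
Proof.
move=> p_pr c0.
have affX n : (aff 1%g c ^+ n)%g = aff 1%g (c *+ n).
  elim: n => [|n IHn]; first by rewrite expg0 mulr0n aff1.
  by rewrite expgSr IHn affM mulg1 perm_mx1 mulmx1 mulrSr.
have : (#[aff 1%g c]%g %| p)%N.
  rewrite order_dvdn affX -scaler_nat.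
  have /andP[_ /eqP ->] := pchar_Fp p_pr.
  by rewrite scale0r aff1.
case/primeP: p_pr => _ pP /pP /orP[|/eqP //].
by rewrite order_eq1 -aff1 => /eqP/aff_trans_inj c00; rewrite c00 eqxx in c0.
Qed.

(** The displacement of h s^-1 under st is that of h under t minus that of h under s^-1. Multiplied
    by 1 + a, the shape equation turns it into 2a times the displacement of h under t. *)
Lemma rot_center_mul (F : fieldType) (d : nat) (s t : 'S_d) (a : F)
    (h : 'rV[F]_d) : a != 0 -> 2%:R != 0 :> F ->
    (1 - a) *: (h *m disp t) = (1 + a) *: (h *m disp s^-1%g) ->
  exists k, k *m disp (s * t)%g = h *m disp t.
Proof.
move=> a0 two0 hE.
exists (((1 + a) / (2%:R * a)) *: (h *m perm_mx s^-1%g)).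
have E : h *m perm_mx s^-1%g *m disp (s * t)%g = h *m disp t - h *m disp s^-1%g.
  rewrite unlock !mulmxBr !mulmx1 -mulmxA -perm_mxM mulKg.
  by rewrite opprB [RHS]addrC addrA subrK.
rewrite -scalemxAl E mulrC -scalerA scalerBr -hE -scalerBl scalerA.
have -> : (2%:R * a)^-1 * (1 + a - (1 - a)) = 1 by field; rewrite a0 two0.
by rewrite scale1r.
Qed.

Lemma snd_mirror_gen (gT : finGroupType) (y z : gT) p :
  p \in <<[set (y, y^-1%g); (z, z^-1%g)]>>%g -> p.2 \in <<[set y; z]>>%g.
Proof.
move: p; apply: gen_ind => [|p q _ + pG]; first by rewrite group1.
rewrite !inE => qE; rewrite /= groupM //.
by case/orP: qE => /eqP -> /=; rewrite groupV mem_gen // !inE eqxx ?orbT.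
Qed.

Lemma mirror_chiral_pair (d : nat) (s t : 'S_d) (b : nat) :
    (0 < d)%N -> transitive_pair s t ->
    (#|porbits s| + #|porbits t| + #|porbits (s * t)%g| <= d)%N ->
  exists (W : finType) (y z : {perm W}),
    [/\ #[y]%g = #[s]%g, #[z]%g = #[t]%g & #[(y * z)%g]%g = #[(s * t)%g]%g] /\
    (b < #|<<[set y; z]>>%g|)%N /\
    exists2 g, (1%g, g) \in <<[set (y, y^-1%g); (z, z^-1%g)]>>%g & g != 1%g.
Proof.
move=> d_gt0 tr_st orb.
(* A prime above this bound makes a translation of order p large enough, and makes d, the order of
   the linear group and 2 invertible. *)
pose b' := (b + d + #|{: 'S_d * 'S_d}| + 2)%N.
have [p [p_pr p_b] [a /and3P[a0 a1 aN1] [det0 free]]] := good_prime d_gt0 tr_st orb b'.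
have [h h0 hP] : exists2 h : 'rV_d, h != 0 & h *m pencil s t a = 0.
  by apply/det0P/eqP.
have d_p : (0 < d < p)%N by rewrite d_gt0 /=; rewrite /b' in p_b; lia.
have [hJ hE] := (pencilP h s t a0 (natr_Fp_neq0 p_pr d_p)).1 hP.
have [k kE] : exists k, k *m disp (s * t)%g = h *m disp t.
  by apply: rot_center_mul a0 _ hE; apply: natr_Fp_neq0; rewrite // /b' in p_b; lia.
have [|c cG c0] := mirror_kernel p_pr d_p _ a0 h0 hP free.
  by rewrite /b' in p_b; lia.
exists ('rV['F_p]_d : finType), (rot 0 s), (rot h t); split.
  by split; [exact: order_rot..|rewrite (rot_mul kE); exact: order_rot].
split; last first.
  exists (aff 1%g c); first exact: cG.
  by apply: contra_neq c0 => c1; apply: aff_trans_inj; rewrite c1 aff1.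
have b_p : (b < p)%N by rewrite /b' in p_b; lia.
have : (#[aff 1%g c]%g <= #|<<[set rot 0 s; rot h t]>>%g|)%N.
  exact: (dvdn_leq (cardG_gt0 _) (order_dvdG (snd_mirror_gen cG))).
rewrite (order_aff_trans p_pr c0); exact: leq_trans b_p.
Qed.

(** * Finite quotients of triangle groups *)

(** A complex primitive N-th root of unity is a root of X^N - 1 but of no X^k - 1 with 0 < k < N,
    and this passes to some prime field. *)
Lemma prim_root_mod_prime (N : nat) : (0 < N)%N ->
  exists2 q : nat, prime q & exists z : 'F_q, N.-primitive_root z.
Proof.
move=> N0; have [z zN] := C_prim_root_exists N0.
pose D : {poly int} := 'X^N - 1.
pose m : {poly int} := \prod_(1 <= k < N) ('X^k - 1).
have rootX (F : fieldType) (x : F) k :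
    root (map_poly intr ('X^k - 1 : {poly int})) x = (x ^+ k == 1).
  by rewrite rmorphB rmorph1 /= map_polyXn rootE !hornerE subr_eq0.
have rootm (F : fieldType) (x : F) :
    root (map_poly intr m) x = has (fun k => x ^+ k == 1) (index_iota 1 N).
  rewrite rmorph_prod; elim: (index_iota 1 N) => [|k s IHs].
    by rewrite big_nil rootC oner_eq0.
  by rewrite big_cons rootM rootX IHs.
have [|||q [q_pr _] [x]] := @root_mod_prime D m z 0.
- by rewrite -size_poly_gt0 size_polyDl ?size_polyXn // size_polyN size_poly1.
- by rewrite rootX (prim_expr_order zN).
- rewrite rootm; apply/hasPn => k; rewrite mem_index_iota => /andP[k0 kN].
  by rewrite -(prim_order_dvd zN) gtnNdvd.
rewrite rootX rootm => xN /hasPn xk; exists q => //; exists x.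
rewrite /primitive_root_of_unity N0; apply/forallP => i.
rewrite unity_rootE; have [->|iN] := eqVneq i.+1 N; first by rewrite xN.
by rewrite eqbF_neg; apply: xk; rewrite mem_index_iota /=; have := ltn_ord i; lia.
Qed.

(** * Orders of elements in the projective linear group of degree 2 *)

Section Projective.
Variable F : finFieldType.
Implicit Types (M X : 'M[F]_2) (a b c : F).

Lemma conj_inj M (uM : M \in unitmx) : injective (fun X => M^-1 * X * M).
Proof. by move=> X Y; move/(mulIr uM)/mulrI; apply; rewrite unitrV. Qed.

(** Conjugation on the matrix algebra realises the image of M in PGL_2 as a permutation, scalar
    matrices acting trivially. *)
Definition conj_perm M (uM : M \in unitmx) : {perm 'M[F]_2} :=
  perm (conj_inj uM).

Lemma conj_permM M N (uM : M \in unitmx) (uN : N \in unitmx)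
    (uMN : M * N \in unitmx) :
  (conj_perm uM * conj_perm uN)%g = conj_perm uMN.
Proof. by apply/permP => X; rewrite permM !permE invrM // !mulrA. Qed.

Lemma ord2_cases (i : 'I_2) : i = 0 \/ i = 1.
Proof. by case: i => [[|[|//]]] i2; [left|right]; apply: val_inj. Qed.

Lemma sum_ord2 (V : nmodType) (f : 'I_2 -> V) : \sum_i f i = f 0 + f 1.
Proof.
rewrite !big_ord_recl big_ord0 addr0; congr (_ + f _).
exact: val_inj.
Qed.

Lemma det2 M : \det M = M 0 0 * M 1 1 - M 0 1 * M 1 0.
Proof.
rewrite (expand_det_row _ 0) sum_ord2 /cofactor !det_mx11 !mxE /=.
rewrite expr0 expr1 mul1r mulN1r mulrN.
by congr (_ * M _ _ - _ * M _ _); apply: val_inj.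
Qed.

Lemma cayley_hamilton2 M : M * M = \tr M *: M - (\det M)%:M.
Proof.
rewrite det2; apply/matrixP => i j; rewrite !mxE /mxtrace !sum_ord2.
by case: (ord2_cases i) => ->; case: (ord2_cases j) => -> /=; ring.
Qed.

(** By Cayley-Hamilton, multiplication by M scales M - a^-1 by a and M - a by a^-1. *)
Lemma expr_eigen2 M a k : \det M = 1 -> \tr M = a + a^-1 -> a != 0 ->
  (a - a^-1) *: M ^+ k =
    a ^+ k *: (M - a^-1%:M) - a^-1 ^+ k *: (M - a%:M).
Proof.
move=> detM trM a0.
have MM : M * M = (a + a^-1) *: M - 1 by rewrite cayley_hamilton2 trM detM.
have e1 : M * (M - a^-1%:M) = a *: (M - a^-1%:M).
  rewrite mulrBr MM [M * _]mul_mx_scalar scalerBr scale_scalar_mx divff //.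
  by rewrite scalerDl addrAC addrK.
have e2 : M * (M - a%:M) = a^-1 *: (M - a%:M).
  rewrite mulrBr MM [M * _]mul_mx_scalar scalerBr scale_scalar_mx mulVf //.
  by rewrite scalerDl [_ *: M + _]addrC addrAC addrK.
elim: k => [|k IHk].
  rewrite !expr0 !scale1r opprB [M - _]addrC addrACA subrr addr0.
  by rewrite addrC -raddfB /= scalemx1.
rewrite exprS scalerAr IHk mulrBr -!scalerAr e1 e2 !scalerA.
by rewrite -!exprSr.
Qed.

Lemma scalar_det_tr M a : \det M = 1 -> \tr M = a + a^-1 -> a != 0 ->
  is_scalar_mx M -> a ^+ 2 = 1.
Proof.
move=> detM trM a0 /is_scalar_mxP[c Mc]; move: detM trM.
rewrite Mc det_scalar mxtrace_scalar => c2 tra.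
have : (a - c) ^+ 2 = 0.
  have -> : (a - c) ^+ 2 = a * (a + a^-1) - 1 - (c *+ 2) * a + c ^+ 2.
    by field.
  by rewrite c2 -tra -mulr_natl; ring.
by move=> /eqP; rewrite sqrf_eq0 subr_eq0 => /eqP ->.
Qed.

Lemma scalar_of_central M : (forall X, M * X = X * M) -> is_scalar_mx M.
Proof.
move=> cM; apply/is_scalar_mxP; exists (M 0 0).
have /matrixP m01 := cM (delta_mx 0 1); have /matrixP m10 := cM (delta_mx 1 0).
have := m01 0 1; have := m01 1 1; have := m10 0 0.
rewrite !mxE !sum_ord2 !mxE /= !(mulr0, mulr1, mul0r, mul1r, add0r, addr0).
move=> m01E m10E m11E; apply/matrixP => i j; rewrite !mxE.
by case: (ord2_cases i) => ->; case: (ord2_cases j) => -> /=; rewrite ?m01E ?m10E ?m11E.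
Qed.

Lemma conj_permX M (uM : M \in unitmx) k X :
  (conj_perm uM ^+ k)%g X = M ^- k * X * M ^+ k.
Proof.
elim: k => [|k IHk]; first by rewrite expg0 perm1 expr0 invr1 mul1r mulr1.
by rewrite expgSr permM IHk permE exprSr invrM ?unitrX // !mulrA.
Qed.

(** Conjugation by M^j is trivial if and only if M^j is scalar, that is, a^j = a^-j, that is, 2k
    divides 2j. M itself is not scalar, because k > 1 excludes a^2 = 1. *)
Lemma order_conj_perm M (uM : M \in unitmx) a k : (1 < k)%N ->
    \det M = 1 -> \tr M = a + a^-1 -> (k.*2).-primitive_root a ->
  #[conj_perm uM]%g = k.
Proof.
move=> k1 detM trM aP.
have a0 : a != 0.
  apply/eqP => a00; have /eqP := prim_expr_order aP.
  by rewrite a00 expr0n double_eq0 (gtn_eqF (ltnW k1)) eq_sym oner_eq0.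
have a21 : a ^+ 2 != 1.
  by rewrite -(prim_order_dvd aP) gtnNdvd //; lia.
have aV : a - a^-1 != 0.
  by rewrite subr_eq0; apply: contra a21 => /eqP E; rewrite expr2 {1}E mulVf.
suff main j : (conj_perm uM ^+ j == 1)%g = (k %| j)%N.
  by apply/eqP; rewrite eqn_dvd -main expg_order eqxx andbT order_dvdn main.
have -> : (k %| j)%N = (a ^+ j == a^-1 ^+ j).
  rewrite exprVn -(inj_eq (mulIf (expf_neq0 j a0))) mulVf ?expf_neq0 //.
  rewrite -exprD addnn.
  by rewrite -(prim_order_dvd aP) -!muln2 dvdn_pmul2r.
have E := expr_eigen2 j detM trM a0.
apply/eqP/eqP => [cj|aj].
  apply/eqP; rewrite -subr_eq0; apply: contraNT a21 => ne0.
  apply/eqP/(scalar_det_tr detM trM a0)/scalar_of_central => X.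
  have Mj Y : M ^+ j * Y = Y * M ^+ j.
    have := conj_permX uM j Y; rewrite cj perm1 => {1}->.
    by rewrite !mulrA divrr ?unitrX // mul1r.
  have Ej : (a ^+ j - a^-1 ^+ j) *: M =
      (a - a^-1) *: M ^+ j + (a ^+ j * a^-1 - a^-1 ^+ j * a)%:M.
    rewrite E; apply/matrixP => i i'; rewrite !mxE.
    by case: eqP => _; rewrite ?mulr1n ?mulr0n; ring.
  apply: (scalerI ne0); rewrite scalerAl scalerAr Ej mulrDl mulrDr -scalerAl -scalerAr.
  by rewrite Mj -[_%:M * X]scalar_mxC.
have Mj : M ^+ j = (a ^+ j)%:M.
  apply: (scalerI aV); rewrite E -aj -scalerBr opprB addrC addrA subrK.
  by rewrite -raddfB /= !scale_scalar_mx mulrC.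
apply/permP => X; rewrite conj_permX perm1 Mj -mulrA [X * _]scalar_mxC mulrA.
by rewrite -Mj mulVr ?mul1r // unitrX.
Qed.

End Projective.

Lemma triangle_quotient (l m n : nat) : (1 < l)%N -> (1 < m)%N -> (1 < n)%N ->
  exists (W : finType) (y z : {perm W}),
    [/\ #[y]%g = m, #[z]%g = n & #[(y * z)%g]%g = l].
Proof.
move=> l1 m1 n1; have N0 : (0 < l.*2 * m.*2 * n.*2)%N.
  by rewrite !muln_gt0 !double_gt0; lia.
have [q q_pr [w wN]] := prim_root_mod_prime N0.
have root_of k : (k.*2 %| l.*2 * m.*2 * n.*2)%N ->
    exists a : 'F_q, k.*2.-primitive_root a.
  by move=> kN; exists (w ^+ (l.*2 * m.*2 * n.*2 %/ k.*2)); apply: dvdn_prim_root.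
have [a aP] : exists a : 'F_q, l.*2.-primitive_root a.
  by apply: root_of; rewrite -mulnA dvdn_mulr.
have [b bP] : exists a : 'F_q, m.*2.-primitive_root a.
  by apply: root_of; rewrite mulnAC dvdn_mull.
have [c cP] : exists a : 'F_q, n.*2.-primitive_root a.
  by apply: root_of; rewrite dvdn_mull.
have prim_neq0 k (x : 'F_q) : (1 < k)%N -> k.*2.-primitive_root x -> x != 0.
  move=> k1 xP; apply/eqP => x0; have /eqP := prim_expr_order xP.
  by rewrite x0 expr0n double_eq0 (gtn_eqF (ltnW k1)) eq_sym oner_eq0.
have b0 := prim_neq0 _ _ m1 bP; have c0 := prim_neq0 _ _ n1 cP.
pose mx (x y z t : 'F_q) : 'M_2 := \matrix_(i, j)
  if i == 0 then if j == 0 then x else y else if j == 0 then z else t.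
have det_mx x y z t : \det (mx x y z t) = x * t - y * z by rewrite det2 !mxE.
have tr_mx x y z t : \tr (mx x y z t) = x + t by rewrite /mxtrace sum_ord2 !mxE.
(* The entry e of [Z] is chosen to give YZ the trace a + a^-1. *)
pose Y := mx b 1 0 b^-1; pose e := a + a^-1 - b * c - b^-1 * c^-1.
pose Z := mx c 0 e c^-1.
have dY : \det Y = 1 by rewrite det_mx mulr0 subr0 divff.
have dZ : \det Z = 1 by rewrite det_mx mul0r subr0 divff.
have uY : Y \in unitmx by rewrite unitmxE dY unitr1.
have uZ : Z \in unitmx by rewrite unitmxE dZ unitr1.
have uYZ : Y * Z \in unitmx by rewrite unitmx_mul uY.
exists ('M['F_q]_2 : finType), (conj_perm uY), (conj_perm uZ).
rewrite (conj_permM uY uZ uYZ).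
split.
- exact: order_conj_perm m1 dY (tr_mx _ _ _ _) bP.
- exact: order_conj_perm n1 dZ (tr_mx _ _ _ _) cP.
apply: order_conj_perm l1 _ _ aP; first by rewrite det_mulmx dY dZ mulr1.
rewrite /mxtrace sum_ord2 !mxE !sum_ord2 !mxE /= /e; ring.
Qed.

Lemma card_porbits_free (d : nat) (s : 'S_d) :
  (forall u i, u \in <[s]>%g -> u i = i -> u = 1%g) ->
  (#|porbits s| * #[s]%g)%N = d.
Proof.
move=> free_s; rewrite -[RHS]card_ord -cardsT.
have part : partition (porbits s) [set: 'I_d].
  have -> : porbits s = [set orbit 'P <[s]>%g i | i in [set: 'I_d]].
    apply/setP => X; apply/imsetP/imsetP => -[i _ ->]; exists i => //.
      by rewrite porbitE.
    by rewrite porbitE.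
  by apply: (orbit_partition (G := <[s]>%G)); apply/actsP => u _ i; rewrite !inE.
apply: esym; apply: card_uniform_partition part => _ /imsetP[i _ ->].
rewrite porbitE card_in_imset // => u v us vs uv.
apply/eqP; rewrite -(inj_eq (mulIg v^-1%g)) mulgV; apply/eqP/(free_s _ i).
  by rewrite groupM ?groupV.
by rewrite permM [u i]uv permK.
Qed.

Section Regular.
Variable gT : finGroupType.
Local Notation d := #|gT|.

Lemma reg_inj (g : gT) :
  injective (fun i : 'I_d => enum_rank (enum_val i * g)%g).
Proof. by move=> i j /enum_rank_inj/mulIg/enum_val_inj. Qed.

Definition reg (g : gT) : 'S_d := perm (@reg_inj g).

Lemma regM g h : reg (g * h)%g = (reg g * reg h)%g.
Proof. by apply/permP => i; rewrite permM !permE enum_rankK mulgA. Qed.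

Lemma reg_free g i : reg g i = i -> g = 1%g.
Proof.
rewrite permE => /(congr1 enum_val); rewrite enum_rankK => /eqP.
by rewrite -{2}[enum_val i]mulg1 (inj_eq (mulgI _)) => /eqP.
Qed.

Canonical reg_morphism :=
  Morphism (in2W regM : {in setT &, {morph reg : g h / (g * h)%g}}).

Lemma injm_reg : ('injm reg)%g.
Proof.
apply/subsetP => g; rewrite !inE /= => /eqP/permP/(_ (enum_rank 1%g)).
by rewrite perm1 => /reg_free ->.
Qed.

Lemma card_porbits_reg g : (#|porbits (reg g)| * #[g]%g)%N = d.
Proof.
rewrite -(order_injm injm_reg) ?inE //; apply: card_porbits_free => u i.
rewrite -morphim_cycle ?inE // => /morphimP[h _ _ ->] /reg_free ->.
exact: morph1.
Qed.

Lemma reg_transitive (y z : gT) : <<[set y; z]>>%g = [set: gT] ->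
  transitive_pair (reg y) (reg z).
Proof.
move=> gen i j; exists (reg ((enum_val i)^-1 * enum_val j)%g); last first.
  by rewrite permE mulKVg enum_valK.
have -> : [set reg y; reg z] = (reg @* [set y; z])%g.
  by rewrite morphimEsub ?subsetT // imsetU !imset_set1.
by rewrite -morphim_gen ?subsetT // gen mem_morphim ?inE.
Qed.

End Regular.

Lemma subg_gen (gT : finGroupType) (y z : gT) (G := <<[set y; z]>>%G) :
  [/\ <<[set subg G y; subg G z]>>%g = [set: subg_of G],
      #[subg G y]%g = #[y]%g, #[subg G z]%g = #[z]%g
    & (subg G y * subg G z)%g = subg G (y * z)].
Proof.
have yG : y \in G by rewrite mem_gen // !inE eqxx.
have zG : z \in G by rewrite mem_gen // !inE eqxx orbT.
have sG : [set y; z] \subset G by apply: subset_gen.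
split; rewrite ?order_injm ?injm_subg ?morphM //.
rewrite -im_subg morphim_gen // morphimEsub // imsetU !imset_set1.
by [].
Qed.

(** In the regular representation all cycles of an element have its order as length, so the numbers
    of cycles are exactly d/m, d/n and d/l. *)
Lemma regular_triple (l m n : nat) : (1 < l)%N -> (1 < m)%N -> (1 < n)%N ->
  exists (d : nat) (s t : 'S_d), [/\ (0 < d)%N, transitive_pair s t,
    [/\ #[s]%g = m, #[t]%g = n & #[(s * t)%g]%g = l] &
    [/\ (#|porbits s| * m)%N = d, (#|porbits t| * n)%N = d
      & (#|porbits (s * t)%g| * l)%N = d]].
Proof.
move=> l1 m1 n1; have [W [y [z [ym zn yzl]]]] := triangle_quotient l1 m1 n1.
have [gen oy oz yz] := subg_gen y z.
pose gT := subg_of <<[set y; z]>>%G; pose y' : gT := subg _ y; pose z' : gT := subg _ z.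
have oyz : #[(y' * z')%g]%g = l.
  rewrite yz order_injm ?injm_subg // groupM // mem_gen // !inE eqxx ?orbT //.
exists #|gT|, (reg y'), (reg z'); rewrite -regM.
rewrite !(order_injm (injm_reg _)) ?inE // oy oz oyz; split=> //.
- by apply/card_gt0P; exists 1%g.
- exact: reg_transitive.
split.
- by rewrite -ym -oy card_porbits_reg.
- by rewrite -zn -oz card_porbits_reg.
- by rewrite -oyz card_porbits_reg.
Qed.

(** * The extended triangle group *)

Local Open Scope group_scope.

Section WordEval.
Variables (T : Type) (G H : groupType).

Lemma word_eval_nil (f : T -> G) : word_eval f [::] = 1.
Proof. by rewrite /word_eval big_nil. Qed.

Lemma word_eval_cat (f : T -> G) u v :
  word_eval f (u ++ v) = word_eval f u * word_eval f v.
Proof. by rewrite /word_eval big_cat. Qed.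

Lemma word_eval_gen (f : T -> G) i : word_eval f [:: (i, false)] = f i.
Proof. by rewrite /word_eval big_seq1. Qed.

Lemma eq_word_eval (f g : T -> G) : f =1 g -> word_eval f =1 word_eval g.
Proof. by move=> fg w; apply: eq_bigr => a _; rewrite fg. Qed.

Lemma word_eval_morph (phi : G -> H) (f : T -> G) w :
    {morph phi : x y / x * y} ->
  phi (word_eval f w) = word_eval (phi \o f) w.
Proof.
move=> phiM; have phi1 : phi 1 = 1.
  by apply: (mulgI (phi 1)); rewrite -phiM !mulg1.
rewrite /word_eval (big_morph phi phiM phi1); apply: eq_bigr => a _.
case: a.2 => //=; apply: (mulgI (phi (f a.1))).
by rewrite -phiM !mulgV.
Qed.

End WordEval.

Section PresentedMorphism.
Variables (T : choiceType) (rels : seq (word T)) (G : groupType) (f : T -> G).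
Hypothesis f_rels : forall r, r \in (rels : seq (seq (T * bool))) ->
  word_eval f r = 1.

Lemma word_cong_eval u v : word_cong rels u v -> word_eval f u = word_eval f v.
Proof.
elim=> // {u v} [u v w _ -> _ ->|u1 v1 u2 v2 _ e1 _ e2|t b|r /f_rels ->] //.
- by rewrite !word_eval_cat e1 e2.
- rewrite /word_eval big_cons big_seq1 big_nil.
  by case: b; rewrite /= ?mulgV ?mulVg.
- by rewrite word_eval_nil.
Qed.

Definition presented_hom (g : presented rels) : G := word_eval f (prepr g).

Lemma presented_hom_class u : presented_hom (pclass rels u) = word_eval f u.
Proof. by apply/word_cong_eval/pclassP; rewrite preprK. Qed.

Lemma presented_homM : {morph presented_hom : g h / g * h}.
Proof. by move=> g h; rewrite [g * h]/(pmul g h) presented_hom_class word_eval_cat. Qed.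

Lemma presented_hom_gen t : presented_hom (pgen rels t) = f t.
Proof. by rewrite presented_hom_class word_eval_gen. Qed.

End PresentedMorphism.

Section Doubling.
Variable D : finType.
Implicit Types g h : {perm D}.

Lemma dbl_inj (g h : {perm D}) :
  injective (fun e : D * bool => (if e.2 then h e.1 else g e.1, e.2)).
Proof. by move=> [d []] [d' []] [] // /perm_inj ->. Qed.

Definition dbl g h : {perm D * bool} := perm (@dbl_inj g h).

Lemma swap_inj : injective (fun e : D * bool => (e.1, ~~ e.2)).
Proof. by move=> [d b] [d' b'] [-> /negb_inj ->]. Qed.

Definition swap : {perm D * bool} := perm swap_inj.

Lemma dblM g h g' h' : dbl g h * dbl g' h' = dbl (g * g') (h * h').
Proof.
by apply/permP => -[d b]; rewrite permM !permE; case: b; rewrite /= ?permM.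
Qed.

Lemma dbl1 : dbl 1 1 = 1.
Proof. by apply/permP => -[d b]; rewrite !permE; case: b; rewrite /= ?perm1 ?permE. Qed.

Lemma dblX g h k : dbl g h ^+ k = dbl (g ^+ k) (h ^+ k).
Proof. by elim: k => [|k IHk]; rewrite ?dbl1 // !expgS IHk dblM. Qed.

Lemma swap2 : swap * swap = 1.
Proof. by apply/permP => -[d b]; rewrite permM !permE /= negbK. Qed.

Lemma swap_dbl g h : swap * dbl g h = dbl h g * swap.
Proof. by apply/permP => -[d b]; rewrite !permM !permE /=; case: b. Qed.

End Doubling.

Lemma word_pow_eval (T : Type) (G : groupType) (f : T -> G) w k :
  word_eval f (word_pow w k) = word_eval f w ^+ k.
Proof.
elim: k => [|k IHk]; first by rewrite word_eval_nil.
by rewrite [word_pow _ _]/(w ++ word_pow w k) word_eval_cat IHk expgS.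
Qed.

Section Chirality.
Variables (l m n : nat) (H : hypermap).
Hypothesis typeH : has_type l m n H.
Local Notation x := (hx H).
Local Notation y := (hy H).
Local Notation z := (hz H).

(* The extended triangle group acts on two copies of the darts, the second one
   being the mirror image of [H]. *)
Definition mirror_action : 'I_3 -> {perm dart H * bool} :=
  triple (swap _) (swap _ * dbl z z^-1) (dbl y y^-1 * swap _).

Lemma mirror_action_rotation :
  [/\ mirror_action i1 * mirror_action i2 = dbl x (z * y),
      mirror_action i2 * mirror_action i0 = dbl y y^-1
    & mirror_action i0 * mirror_action i1 = dbl z z^-1].
Proof.
have xE : x = z^-1 * y^-1.
  by apply: (mulIg y); apply: (mulIg z); rewrite hxyz mulgKV mulVg.
rewrite /mirror_action /triple !(tnth_nth 1) /=; split.
- by rewrite mulgA -[_ * dbl y _]mulgA dblM swap_dbl -mulgA swap2 mulg1 -xE.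
- by rewrite -mulgA swap2 mulg1.
- by rewrite mulgA swap2 mul1g.
Qed.

Lemma mirror_action_rels r : r \in ext_triangle_rels l m n ->
  word_eval mirror_action r = 1.
Proof.
have [r12 r20 r01] := mirror_action_rotation.
have [xl ym zn] := typeH.
have eval2 i j : word_eval mirror_action (prod2 i j) = mirror_action i * mirror_action j.
  rewrite -[prod2 i j]/([:: (i, false)] ++ [:: (j, false)]) word_eval_cat.
  by rewrite !word_eval_gen.
have sq g h : swap _ * dbl g h * (swap _ * dbl g h) = dbl (h * g) (g * h).
  by rewrite {1}swap_dbl -mulgA [swap _ * (_ * _)]mulgA swap2 mul1g dblM.
rewrite !inE => /or4P[||| /or3P[]] /eqP ->.
- by rewrite eval2 /mirror_action /triple !(tnth_nth 1) swap2.
- rewrite eval2 /mirror_action /triple !(tnth_nth 1) /= sq.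
  by rewrite mulgV mulVg dbl1.
- rewrite eval2 /mirror_action /triple !(tnth_nth 1) /=.
  by rewrite -swap_dbl sq mulgV mulVg dbl1.
- rewrite word_pow_eval eval2 r12 dblX -xl expg_order.
  (* On the mirror copy the rotation x acts as zy, a conjugate of yz = x^-1, so it has the same
     order. *)
  have -> : z * y = (x^-1) ^ y.
    have -> : x^-1 = y * z by apply: (mulgI x); rewrite mulgV mulgA hxyz.
    by rewrite conjgE -mulgA mulKg.
  by rewrite -conjXg expVgn expg_order invg1 conj1g dbl1.
- by rewrite word_pow_eval eval2 r20 dblX -ym expVgn expg_order invg1 dbl1.
by rewrite word_pow_eval eval2 r01 dblX -zn expVgn expg_order invg1 dbl1.
Qed.

Definition mirror_hom : ext_triangle_group l m n -> {perm dart H * bool} :=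
  presented_hom mirror_action.

Lemma dbl_word_eval (f f' : 'I_3 -> {perm dart H}) w :
  word_eval (fun i => dbl (f i) (f' i)) w = dbl (word_eval f w) (word_eval f' w).
Proof.
elim: w => [|[i b] w IHw]; first by rewrite !word_eval_nil dbl1.
rewrite -[_ :: w]cat1s !word_eval_cat IHw -dblM; congr (_ * _).
rewrite /word_eval !big_seq1 /=.
case: b => //=; apply: (mulgI (dbl (f i) (f' i))).
by rewrite mulgV dblM !mulgV dbl1.
Qed.

Lemma mirror_hom_rotation w :
  mirror_hom (word_eval (rotation l m n) w) =
  dbl (word_eval (triple x y z) w) (word_eval (triple (z * y) y^-1 z^-1) w).
Proof.
have homM : {morph mirror_hom : g h / g * h}.
  exact: presented_homM mirror_action_rels.
have homE i : mirror_hom (reflection l m n i) = mirror_action i.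
  exact: (presented_hom_gen mirror_action_rels).
have [r12 r20 r01] := mirror_action_rotation.
rewrite (word_eval_morph _ _ homM) -dbl_word_eval; apply: eq_word_eval => i.
rewrite /= /rotation /triple !(tnth_nth 1).
by case: i => [[|[|[|//]]]] ? /=; rewrite homM !homE.
Qed.

(** Elements of the hypermap subgroup act trivially on the first copy of the darts. Conjugation by
    r0 exchanges the copies, so it takes the element of w, nontrivial on the second copy, out of the
    subgroup. *)
Lemma chiral_of_word w :
    word_eval (triple x y z) w = 1 ->
    word_eval (triple (z * y) y^-1 z^-1) w <> 1 ->
  chiral l m n H.
Proof.
move=> w1 w'1 refl.
pose g := word_eval (rotation l m n) w.
have [|w2 w21 gE] := refl g (reflection l m n i0); first by exists w.
have homM : {morph mirror_hom : g h / g * h}.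
  exact: presented_homM mirror_action_rels.
have : mirror_hom (reflection l m n i0 * g ^ reflection l m n i0) =
       mirror_hom (g * reflection l m n i0) by rewrite -conjgC.
have hom0 : mirror_hom (reflection l m n i0) = swap _.
  exact: (presented_hom_gen mirror_action_rels).
rewrite gE !homM !mirror_hom_rotation hom0 w1 w21 swap_dbl => /mulIg eqD.
apply: w'1; apply/permP => d; have /permP/(_ (d, true)) := eqD.
by rewrite !permE /= ?permE => -[].
Qed.

End Chirality.

(** * Regular hypermaps from finite groups with two generators *)

Section GroupHypermap.
Variables (gT : finGroupType) (y z : gT).
Hypothesis gen_yz : <<[set y; z]>> = [set: gT].

Definition rmul (g : gT) : {perm gT} := perm (mulIg g).

Lemma rmulE g a : rmul g a = a * g.
Proof. by rewrite permE. Qed.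

Lemma rmulM g h : rmul (g * h) = rmul g * rmul h.
Proof. by apply/permP => a; rewrite permM !rmulE mulgA. Qed.

Canonical rmul_morphism :=
  Morphism (in2W rmulM : {in setT &, {morph rmul : g h / g * h}}).

Lemma rmul_eq1 g : rmul g = 1 -> g = 1.
Proof. by move/permP/(_ 1); rewrite rmulE mul1g perm1. Qed.

Lemma injm_rmul : 'injm rmul.
Proof. by apply/subsetP => g; rewrite !inE /= => /eqP/rmul_eq1 ->. Qed.

Lemma rmul_xyz : rmul (y * z)^-1 * rmul y * rmul z = 1.
Proof. by rewrite -!rmulM -mulgA mulVg; apply: (morph1 rmul_morphism). Qed.

Lemma rmul_transitive :
  [transitive <<[set rmul (y * z)^-1; rmul y; rmul z]>>, on [set: gT] | 'P].
Proof.
apply/imsetP; exists 1; rewrite ?inE //; apply/setP => g; rewrite inE.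
apply/esym/orbitP; exists (rmul g); last by rewrite /= apermE rmulE mul1g.
have : rmul g \in rmul @* <<[set y; z]>> by rewrite gen_yz mem_morphim ?inE.
rewrite morphim_gen ?subsetT // morphimEsub ?subsetT // imsetU !imset_set1.
by apply/subsetP/genS/subsetP => h; rewrite !inE -orbA => ->; rewrite orbT.
Qed.

Definition group_hypermap : hypermap := Hypermap rmul_xyz rmul_transitive.

Lemma group_hypermap_type :
  has_type #[y * z] #[y] #[z] group_hypermap.
Proof. by split; rewrite /= (order_injm injm_rmul) ?inE // orderV. Qed.

(** Left multiplications commute with right multiplications and are transitive. *)
Lemma group_hypermap_regular : orientably_regular group_hypermap.
Proof.
move=> d e; exists (fun a : gT => e * d^-1 * a); last by rewrite mulgKV.
split=> [|a|a|a]; rewrite /= ?rmulE ?mulgA //.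
by exists (fun a => d * e^-1 * a) => a; rewrite !mulgA mulgKV mulgV mul1g.
Qed.

End GroupHypermap.

Lemma mirror_word (gT : finGroupType) (y z : gT) p :
    p \in <<[set (y, y^-1); (z, z^-1)]>> ->
  exists w : word 'I_3,
    p = (word_eval (triple (y * z)^-1 y z) w,
         word_eval (triple (z * y) y^-1 z^-1) w).
Proof.
move: p; apply: gen_ind => [|p q _ + [w ->]].
  by exists [::]; rewrite !word_eval_nil.
rewrite !inE => /orP[]/eqP ->; [exists (w ++ [:: (i1, false)])|
  exists (w ++ [:: (i2, false)])];
  by rewrite !word_eval_cat !word_eval_gen /triple !(tnth_nth 1).
Qed.

Lemma word_eval_subg (gT : finGroupType) (G : {group gT}) (f : 'I_3 -> gT)
    (F : 'I_3 -> subg_of G) w : (forall i, sgval (F i) = f i) ->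
  sgval (word_eval F w) = word_eval f w.
Proof.
move=> Ff; have sgM : {morph (@sgval gT G) : u v / u * v}.
  by move=> u v; rewrite sgvalM ?inE.
rewrite (word_eval_morph _ _ sgM).
exact: eq_word_eval.
Qed.

Lemma chiral_hypermap (l m n b : nat) : (1 < l)%N -> (1 < m)%N -> (1 < n)%N ->
    (l%:R^-1 + m%:R^-1 + n%:R^-1 <= 1 :> rat)%R ->
  exists2 H : hypermap,
    [/\ orientably_regular H, chiral l m n H & has_type l m n H] &
    (b < #|dart H|)%N.
Proof.
move=> l1 m1 n1 lmn.
have [d [s [t [d0 tr_st [sm tn stl] [ds dt dst]]]]] := regular_triple l1 m1 n1.
(* Non-sphericity, multiplied by d. *)
have orb : (#|porbits s| + #|porbits t| + #|porbits (s * t)| <= d)%N.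
  have inv_orb (o k : nat) : (1 < k)%N -> (o * k)%N = d ->
      (o%:R = d%:R * k%:R^-1 :> rat)%R.
    by move=> k1 <-; rewrite natrM mulfK // pnatr_eq0; lia.
  rewrite -(ler_nat rat) !natrD (inv_orb _ _ m1 ds) (inv_orb _ _ n1 dt).
  rewrite (inv_orb _ _ l1 dst) -!mulrDr -[leRHS]mulr1 ler_wpM2l ?ler0n //.
  by rewrite addrC addrA.
have [W [y [z [[oy oz oyz] [b_card [g gP g1]]]]]] := mirror_chiral_pair b d0 tr_st orb.
have [w [w1 gE]] := mirror_word gP.
have [gen oy' oz' yz'] := subg_gen y z.
pose G := <<[set y; z]>>%G.
pose Y : subg_of G := subg G y; pose Z : subg_of G := subg G z.
have yG : y \in G by rewrite mem_gen // !inE eqxx.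
have zG : z \in G by rewrite mem_gen // !inE eqxx orbT.
have sgY : sgval Y = y by rewrite subgK.
have sgZ : sgval Z = z by rewrite subgK.
have sgV (u : subg_of G) : sgval u^-1 = (sgval u)^-1 by [].
have sgM (u v : subg_of G) : sgval (u * v) = sgval u * sgval v by [].
have typeH : has_type l m n (group_hypermap gen).
  have := group_hypermap_type gen; rewrite oy' oz' oy oz sm tn; congr has_type.
  by rewrite yz' order_injm ?injm_subg ?groupM // oyz stl.
exists (group_hypermap gen); last first.
  by rewrite /= -cardsT -(im_subg G) card_injm ?injm_subg.
split=> //; first exact: group_hypermap_regular.
have rmul_eval (F : 'I_3 -> subg_of G) u :
    word_eval (fun i => rmul (F i)) u = rmul (word_eval F u).
  by rewrite (word_eval_morph _ _ (@rmulM _)).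
apply: (chiral_of_word typeH (w := w)) => /=.
  rewrite (eq_word_eval (g := fun i => rmul (triple (Y * Z)^-1 Y Z i))).
    rewrite rmul_eval (_ : word_eval _ w = 1) ?morph1 //.
    apply: val_inj; rewrite /= (word_eval_subg (f := triple (y * z)^-1 y z)) //.
    case=> -[|[|[|//]]] i; rewrite /triple !(tnth_nth 1) /= ?sgV ?sgM ?sgY ?sgZ //.
  by case=> -[|[|[|//]]] i; rewrite /triple !(tnth_nth 1).
rewrite (eq_word_eval (g := fun i => rmul (triple (Z * Y) Y^-1 Z^-1 i))).
  rewrite rmul_eval => w1'; move/eqP: g1; apply.
  rewrite gE -(word_eval_subg (F := triple (Z * Y) Y^-1 Z^-1)) => [|i].
    suff -> : word_eval (triple (Z * Y) Y^-1 Z^-1) w = 1 by [].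
    exact: rmul_eq1 w1'.
  by case: i => -[|[|[|//]]] ? /=; rewrite /triple !(tnth_nth 1) /= ?sgV ?sgM ?sgY ?sgZ.
by case=> -[|[|[|//]]] i; rewrite /triple !(tnth_nth 1) /= ?rmulM //;
  rewrite (morphV (rmul_morphism _)) ?inE.
Qed.

Local Close Scope group_scope.
Local Close Scope ring_scope.

Theorem corollary2p2 (l m n : nat) (hl : 0 < l) (hm : 0 < m) (hn : 0 < n)
    (hlmn : (l%:R^-1 + m%:R^-1 + n%:R^-1 <= 1 :> rat)%R) :
  exists H : nat -> hypermap,
    (forall i : nat, [/\ orientably_regular (H i), chiral l m n (H i)
                       & has_type l m n (H i)]) /\
    (forall i j : nat, i <> j -> ~ isomorphic (H i) (H j)).
Proof.
(* A period equal to 1 would push the sum of the reciprocals above 1. *)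
have gt1 (a b c : nat) : 0 < a -> 0 < b -> 0 < c ->
    (a%:R^-1 + b%:R^-1 + c%:R^-1 <= 1 :> rat)%R -> 1 < a.
  case: a => [|[|a]] // _ b0 c0; rewrite invr1 -addrA gerDl leNgt.
  by rewrite addr_gt0 // invr_gt0 ltr0n.
have l1 := gt1 _ _ _ hl hm hn hlmn.
have m1 : 1 < m by apply: (gt1 m l n) => //; rewrite [(m%:R^-1 + _)%R]addrC.
have n1 : 1 < n by apply: (gt1 n l m) => //; rewrite -addrA addrC.
have [f fP] := boolp.choice (fun b =>
  let: ex_intro2 H H1 H2 := chiral_hypermap b l1 m1 n1 hlmn in
  ex_intro _ H (conj H1 H2)).
(* Each hypermap has more darts than its predecessor, so no two are isomorphic. *)
pose H := fix H i := if i is j.+1 then f #|dart (H j)| else f 0.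
have mono : {homo (fun i => #|dart (H i)|) : i j / i < j}.
  by apply: homo_ltn => [|i]; [apply: ltn_trans|apply: (fP _).2].
exists H; split=> [[|i]|i j ij [g [/bij_eq_card eq_ij _ _ _]]]; try exact: (fP _).1.
have [lt_ij|lt_ji|//] := ltngtP i j.
  by have := mono _ _ lt_ij; rewrite eq_ij ltnn.
by have := mono _ _ lt_ji; rewrite eq_ij ltnn.
Qed.
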